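(* Let $T=\{f_1,\dots,f_m\}$, $m\ge2$, be a self-similar IFS on $\mathbb{R}^d$ with attractor $K$, and assume that $T$ satisfies the asymptotically weak separation condition (AWSC). Let $\eta:\mathbb{R}_+\to\mathbb{R}_+$ be non-decreasing and let $\delta_\eta=\liminf_{r\to0^+}\frac{\log\eta(r)}{\log r}$. Then the set of $y\in K$ such that $$\big\|y-\pi\big((i_1,\dots,i_n,(i_{k+1},\dots,i_n)_\infty)\big)\big\|_\infty\leq\eta\big(|f_{i_1}\circ\cdots\circ f_{i_n}(K)|\big)$$ for infinitely many choices of a word $(i_1,\dots,i_n)\in\bigcup_{p\geq1}\{1,\dots,m\}^p$ and an integer $0\leq k\leq n-1$ has Hausdorff dimension $$\frac{\dim_H K}{\max\{1,\delta_\eta\}}.$$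
   Context: A self-similar IFS is a finite family of contracting similarities $f_i(x)=\lambda_iO_ix+a_i$ of $\mathbb{R}^d$ with $\lambda_i\in(-1,1)\setminus\{0\}$, $O_i$ orthogonal, $a_i\in\mathbb{R}^d$; the contraction ratio of $f_i$ is $c_i=|\lambda_i|$. The attractor $K$ is the unique non-empty compact set with $K=\bigcup_if_i(K)$. For a word $\underline{i}=(i_1,\dots,i_n)$, $f_{\underline{i}}=f_{i_1}\circ\cdots\circ f_{i_n}$ and $c_{\underline{i}}=c_{i_1}\cdots c_{i_n}$ (equal to $1$ for the empty word). $|E|$ denotes the diameter of a set $E$ (with respect to $\|\cdot\|_\infty$), and $B(x,r)$ is the closed $\|\cdot\|_\infty$-ball. The canonical projection is $\pi((j_n)_n)=\lim_{n\to+\infty}f_{j_1}\circ\cdots\circ f_{j_n}(0)$, and $(i_{k+1},\dots,i_n)_\infty$ denotes infinite periodic repetition of the block. For $r>0$ let $\Lambda_r=\{(i_1,\dots,i_n):\ n\geq1,\ c_{(i_1,\dots,i_n)}\leq r<c_{(i_1,\dots,i_{n-1})}\}$. $T$ satisfies the AWSC if $$\lim_{r\to0^+}\frac{\log\big(\sup_{x\in K}\#\{f_{\underline{i}}:\ \underline{i}\in\Lambda_r,\ f_{\underline{i}}(K)\cap B(x,r)\neq\emptyset\}\big)}{\log r}=0,$$ where distinct maps (not words) are counted. Conventions: $\log0=-\infty$ and $c/{+\infty}=0$ for $0\le c<\infty$. *)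

(* Defs.v *)
From HB Require Import structures.
From mathcomp Require Import all_boot all_order all_algebra.
From mathcomp Require Import all_classical all_reals all_analysis.

Set Implicit Arguments.
Unset Strict Implicit.
Unset Printing Implicit Defensive.

Import Order.TTheory GRing.Theory Num.Theory.
Import numFieldNormedType.Exports.

Local Open Scope classical_set_scope.
Local Open Scope ring_scope.

(** The norm [`|x|] on ['cV[R]_d] is the library's matrix norm, i.e. the
    sup norm; all diameters, balls and distances below refer to it. *)

(** [ediam set0 = -oo]; for a non-empty set this is the usual diameter. *)
Definition ediam (R : realType) (d : nat) (A : set 'cV[R]_d) : \bar R :=
  ereal_sup [set `|x - y|%:E | x in A & y in A].

Definition diam (R : realType) (d : nat) (A : set 'cV[R]_d) : R :=
  fine (ediam A).

(** [diam(U)^s], with the convention that the empty set contributes 0 also for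
    [s = 0] (whereas a singleton then contributes [0^0 = 1]). *)
Definition hausdorff_gauge (R : realType) (d : nat) (s : R)
    (U : set 'cV[R]_d) : \bar R :=
  if U == set0 then 0%E else poweR (ediam U) s.

Definition hausdorff_premeasure (R : realType) (d : nat) (s delta : R)
    (A : set 'cV[R]_d) : \bar R :=
  ereal_inf [set (\sum_(0 <= i <oo) hausdorff_gauge s (U i))%E
            | U in [set U : nat -> set 'cV[R]_d |
                     A `<=` \bigcup_i U i /\
                     forall i, (ediam (U i) <= delta%:E)%E]].

Definition hausdorff_measure (R : realType) (d : nat) (s : R)
    (A : set 'cV[R]_d) : \bar R :=
  ereal_sup [set hausdorff_premeasure s delta A
            | delta in [set delta : R | 0 < delta]].

Definition hausdorff_dim (R : realType) (d : nat) (A : set 'cV[R]_d) : \bar R :=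
  ereal_inf [set s%:E
            | s in [set s : R | 0 <= s /\ hausdorff_measure s A = 0%E]].

Record similarity (R : realType) (d : nat) := Similarity {
  sim_lambda : R;
  sim_orth : 'M[R]_d;
  sim_trans : 'cV[R]_d;
  sim_lambda_bounds : -1 < sim_lambda < 1;
  sim_lambda_neq0 : sim_lambda != 0;
  sim_orthP : sim_orth^T *m sim_orth = 1%:M
}.

Definition sim_fun (R : realType) (d : nat) (f : similarity R d)
    (x : 'cV[R]_d) : 'cV[R]_d :=
  sim_lambda f *: (sim_orth f *m x) + sim_trans f.

Coercion sim_fun : similarity >-> Funclass.

Definition sim_ratio (R : realType) (d : nat) (f : similarity R d) : R :=
  `|sim_lambda f|.

Definition is_attractor (R : realType) (d m : nat) (T : 'I_m -> similarity R d)
    (K : set 'cV[R]_d) : Prop :=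
  [/\ K !=set0, compact K & K = \bigcup_(i : 'I_m) (T i @` K)].

(** Words [(i_1, ..., i_n)] are sequences of letters, [i_1] being the head. *)
Definition word_map (R : realType) (d m : nat) (T : 'I_m -> similarity R d)
    (w : seq 'I_m) : 'cV[R]_d -> 'cV[R]_d :=
  foldr (fun i g => T i \o g) idfun w.

Definition word_ratio (R : realType) (d m : nat) (T : 'I_m -> similarity R d)
    (w : seq 'I_m) : R :=
  \prod_(i <- w) sim_ratio (T i).

(** [take (size w).-1 w] is [w] without its last letter. *)
Definition cutset (R : realType) (d m : nat) (T : 'I_m -> similarity R d)
    (r : R) : set (seq 'I_m) :=
  [set w | (0 < size w)%N /\
           word_ratio T w <= r < word_ratio T (take (size w).-1 w)].

(** The image set identifies words inducing the same map. *)
Definition maps_near (R : realType) (d m : nat) (T : 'I_m -> similarity R d)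
    (K : set 'cV[R]_d) (r : R) (x : 'cV[R]_d) : set ('cV[R]_d -> 'cV[R]_d) :=
  [set word_map T w | w in
    [set w | cutset T r w /\
             (word_map T w @` K) `&` [set y | `|y - x| <= r] !=set0]].

(** [counting] is the cardinality, [+oo] on infinite sets; [lne] is the
    logarithm extended by [lne 0 = -oo]. *)
Definition AWSC (R : realType) (d m : nat) (T : 'I_m -> similarity R d)
    (K : set 'cV[R]_d) : Prop :=
  (lne (ereal_sup [set (counting (maps_near T K r x) : \bar R) | x in K])
     / (ln r)%:E)%E @[r --> 0^'+] --> (0%E : \bar R).

Definition canonical_proj (R : realType) (d m : nat)
    (T : 'I_m -> similarity R d) (j : nat -> 'I_m) : 'cV[R]_d :=
  lim (word_map T (mkseq j n) 0 @[n --> \oo]).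

(** The infinite sequence [(i_1, ..., i_n, (i_{k+1}, ..., i_n)_oo)] for
    [w = (i_1, ..., i_n)] and [k < n]. The default [x0] of [nth] is never
    reached since the index is always [< size w]. *)
Definition eventually_periodic (A : Type) (x0 : A) (w : seq A) (k : nat) :
    nat -> A :=
  fun j => nth x0 w
    (if (j < size w)%N then j else (k + (j - size w) %% (size w - k))%N).

(** With [lne 0 = -oo], the quotient is [+oo] wherever [eta r = 0], [r < 1]. *)
Definition lower_log_order (R : realType) (eta : R -> R) : \bar R :=
  limf_einf (fun r : R => (lne (eta r)%:E / (ln r)%:E)%E) (0 : R)^'+.

(* Main.v *)
Require Import Defs.
From mathcomp Require Import all_boot all_order all_algebra.
From mathcomp Require Import all_classical all_reals all_analysis.
From mathcomp Require finmap.
From mathcomp Require Import ring lra zify.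

(** Write [s] for the Hausdorff dimension of [K] and [delta] for the lower
    logarithmic order of [eta]; the scale of a word is its contraction ratio.

    The point coded by [(i_1, ..., i_n, (i_(k+1), ..., i_n)_oo)] is the image,
    under the map of the preperiod, of the fixed point of the map of the period
    ([eventually_periodic_proj]). It depends on two maps only, not on the words.

    Upper bound. The set of the theorem lies in [K], so its dimension is at most
    [s]. When [1 < Delta < delta] it is also contained in the limsup of the
    balls of radius at most [r ^ Delta], up to constants, around the coded
    points of scale [r]. Such a point is given by two maps of scales [r1] and
    [r2] with [r1 r2] comparable to [r], so there are about
    [log (1/r) r ^ (- s1)] of them, for any [s1 > s], provided that there are at
    most [C r ^ (- s1)] maps of scale [r] ([level_maps]). The latter holds
    because [K] is covered by about [r ^ (- s)] balls of radius [r], each of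
    which meets a subpolynomial number of pieces by the separation condition.
    The series of the [t]-th powers of the diameters converges for
    [t > s / Delta], and [hausdorff_cantelli] concludes.

    That [K] has covering numbers [r ^ (- s)], with [s] its Hausdorff dimension,
    is a feature of self-similar sets. At every scale [r] take a maximal family
    of words whose pieces have size about [r] and are far apart
    ([separated_family]). Its concatenations code a subset of [K] in which the
    pieces of each generation are separated; if the family is too large this
    Cantor set has dimension greater than [s]
    ([separated_family_size_le]), and if it is too small then so is [K], which
    is covered by balls centred at the chosen pieces
    ([separated_family_size_ge]).

    Lower bound. The same families serve here as strongly separated subsystems.
    For [Delta > max 1 delta] there are arbitrarily small [r] with
    [r ^ Delta <= eta r]. Fix a small scale and a separated family, and
    consider the sequences of its words which are free except in very sparse
    windows from position [n] to position about [Delta n], where one and the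
    same word is repeated. A point coded by such a sequence follows, until the
    end of the window, the eventually periodic sequence whose preperiod is the
    prefix of length [n]; hence it is as close to its point as required, once
    the windows start at suitable positions ([good_scale]). At the end of a
    window a proportion [1 / Delta] of the letters has been free, at worst
    ([free_count_windows]), so these points form a set of dimension about
    [s / Delta] ([subsystem_hausdorff]).

    The dimension of the Cantor sets is bounded from below by a mass
    distribution argument carried out on the coding sequences
    ([cylinder_cover], [cantor_hausdorff]). *)

Set Implicit Arguments.
Unset Strict Implicit.
Unset Printing Implicit Defensive.

Import Order.TTheory GRing.Theory Num.Theory.
Import numFieldNormedType.Exports.

Local Open Scope classical_set_scope.
Local Open Scope ring_scope.

(** * Elementary estimates *)

Lemma expr_small (R : realType) (b e : R) : 0 <= b -> b < 1 -> 0 < e ->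
  exists N, forall n, (N <= n)%N -> b ^+ n < e.
Proof.
move=> b0 b1 e0.
have /cvgrPdist_lt/(_ e e0)[N _ HN] : (b ^+ n @[n --> \oo] --> 0).
  by apply: cvg_expr; rewrite ger0_norm.
exists N => n /HN /=; rewrite sub0r normrN ger0_norm ?exprn_ge0//.
Qed.

Definition short_words (m n : nat) : seq (seq 'I_m) :=
  flatten [seq [seq val t | t <- enum {: k.-tuple 'I_m}] | k <- iota 0 n.+1].

Lemma mem_short_words m n (w : seq 'I_m) :
  (w \in short_words m n) = (size w <= n)%N.
Proof.
apply/flattenP/idP => [[s /mapP[k]]|wn].
  rewrite mem_iota ltnS => /andP[_ kn] -> /mapP[t _ ->].
  by rewrite size_tuple.
exists [seq val t | t <- enum {: (size w).-tuple 'I_m}].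
  by apply/mapP; exists (size w) => //; rewrite mem_iota.
by apply/mapP; exists (in_tuple w) => //; rewrite mem_enum.
Qed.

(** Greedy selection: a point is kept when it is far from those kept before. *)
Lemma maximal_separated (R : realDomainType) (W : normedZmodType R) (I : eqType)
    (f : I -> W) (e : R) (L : seq I) : 0 <= e ->
  exists V, [/\ uniq V, {subset V <= L},
    forall i j, i \in V -> j \in V -> i != j -> e < `|f i - f j| &
    forall k, k \in L -> exists2 i, i \in V & `|f k - f i| <= e].
Proof.
move=> e0; elim: L => [|w L [V [uV sV sepV covV]]].
  by exists [::]; split.
have [[v vV wv]|nV] := pselect (exists2 v, v \in V & `|f w - f v| <= e).
  exists V; split => // [x /sV xL|x]; first by rewrite in_cons xL orbT.
  by rewrite in_cons => /orP[/eqP ->|/covV//]; exists v.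
have far v : v \in V -> e < `|f w - f v|.
  by move=> vV; rewrite ltNge; apply/negP => wv; apply: nV; exists v.
exists (w :: V); split.
- rewrite /= uV andbT; apply/negP => /far.
  by rewrite subrr normr0 ltNge e0.
- by move=> x; rewrite !in_cons => /orP[->//|/sV ->]; rewrite orbT.
- move=> u v; rewrite !in_cons => /orP[/eqP ->|uV'] /orP[/eqP ->|vV'].
  + by rewrite eqxx.
  + by move=> _; exact: far.
  + by move=> _; rewrite distrC; exact: far.
  + exact: sepV.
- move=> x; rewrite in_cons => /orP[/eqP ->|/covV[v vV xv]].
    by exists w; rewrite ?mem_head// subrr normr0.
  by exists v => //; rewrite in_cons vV orbT.
Qed.

Lemma powR_lt1 (R : realType) (a x : R) : 0 <= a -> a < 1 -> 0 < x -> a `^ x < 1.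
Proof.
move=> a0 a1 x0; have := gt0_ltr_powR x0 (_ : a \in Num.nneg) (_ : 1 \in Num.nneg) a1.
by rewrite powR1; apply; rewrite nnegrE.
Qed.

Lemma powR_exprn (R : realType) (a e : R) n : 0 <= a ->
  (a ^+ n) `^ e = (a `^ e) ^+ n.
Proof. by move=> a0; rewrite -!powR_mulrn ?powR_ge0// powRAC. Qed.

Lemma powR_small (R : realType) (x c : R) : 0 < x -> 0 < c ->
  exists2 r0, 0 < r0 < 1 & forall r, 0 < r -> r < r0 -> r `^ x <= c.
Proof.
move=> x0 c0; exists (Num.min (1/2) (c `^ x^-1)).
  by rewrite lt_min powR_gt0// gt_min; apply/andP; split; [lra|apply/orP; left; lra].
move=> r r0; rewrite lt_min => /andP[_ rc].
rewrite -[leRHS]powRr1 ?(ltW c0)// -(@mulVf _ x) ?gt_eqF// powRrM.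
by apply: (ge0_ler_powR (ltW x0)); rewrite ?nnegrE ?powR_ge0 ?(ltW r0) ?(ltW rc).
Qed.

(** Absorbs the number of ways to split a scale into the scales of a preperiod
    and of a period. *)
Lemma arithmetic_geometric_le (R : realFieldType) (x : R) : 0 < x -> x < 1 ->
  exists C y : R, [/\ 0 <= C, 0 <= y, y < 1 &
    forall j, j.+1%:R * x ^+ j <= C * y ^+ j].
Proof.
(* [h] is such that [x * (1 + h)] is halfway between [x] and [1]. *)
move=> x_gt0 x1; pose h : R := (1 - x) / (2 * x).
have h0 : 0 < h by rewrite divr_gt0 ?mulr_gt0// subr_gt0.
have xy : x * (1 + h) = (1 + x) / 2.
  by rewrite /h; field; rewrite gt_eqF.
have bernoulli j : 1 + j%:R * h <= (1 + h) ^+ j.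
  elim: j => [|j IH]; first by rewrite mul0r addr0 expr0.
  rewrite exprS -natr1; apply: (@le_trans _ _ ((1 + h) * (1 + j%:R * h))).
    have : 0 <= j%:R * h * h by exact: mulr_ge0 (mulr_ge0 (ler0n _ _) (ltW h0)) (ltW h0).
    by rewrite -subr_ge0 => H; rewrite -subr_ge0; apply: le_trans H _; lra.
  by rewrite ler_pM2l// addr_gt0.
exists (1 + h^-1), (x * (1 + h)); rewrite xy; split; try lra.
  by rewrite addr_ge0// invr_ge0 ltW.
move=> j; rewrite -xy exprMn mulrCA mulrC ler_wpM2l ?exprn_ge0 ?(ltW x_gt0)//.
apply: (@le_trans _ _ ((1 + h^-1) * (1 + j%:R * h))); last first.
  by rewrite ler_wpM2l// addr_ge0// invr_ge0 ltW.
have -> : (1 + h^-1) * (1 + j%:R * h) = j.+1%:R + h^-1 + j%:R * h.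
  by rewrite -natr1; field; rewrite gt_eqF.
by rewrite -addrA lerDl addr_ge0 ?invr_ge0 ?(ltW h0)// mulr_ge0 ?ler0n ?(ltW h0).
Qed.

Lemma size_flatten_le (R : numDomainType) (I : eqType) (A : Type) (s1 : seq I)
    (f : I -> seq A) (M : R) :
  (forall i, i \in s1 -> (size (f i))%:R <= M) ->
  (size (flatten [seq f i | i <- s1]))%:R <= (size s1)%:R * M.
Proof.
elim: s1 => [|i s1 IH] fM /=; first by rewrite mul0r.
rewrite size_cat natrD -natr1 mulrDl mul1r addrC lerD//; last by rewrite fM// mem_head.
by apply: IH => j js; rewrite fM// in_cons js orbT.
Qed.

Lemma flatten_mkseqD (A : Type) (b : nat -> seq A) n k :
  flatten (mkseq b (n + k)) =
  flatten (mkseq b n) ++ flatten (mkseq (fun i => b (n + i)%N) k).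
Proof.
rewrite /mkseq iotaD map_cat flatten_cat add0n; congr (_ ++ flatten _).
by rewrite -[in LHS](addn0 n) iotaDl -map_comp.
Qed.

Lemma size_flatten_mkseq (A : Type) (b : nat -> seq A) n :
  (forall i, (0 < size (b i))%N) -> (n <= size (flatten (mkseq b n)))%N.
Proof.
move=> b0; elim: n => [//|n IH].
rewrite -addn1 flatten_mkseqD size_cat leq_add// /mkseq /= cats0.
exact: b0.
Qed.

(** * Words and their maps *)

Section Words.
Variables (R : realType) (d m : nat).
Hypothesis hd : (0 < d)%N.
Variable (T : 'I_m -> similarity R d).
Implicit Types (u v w : seq 'I_m) (x y : 'cV[R]_d).

Definition sqnorm x : R := \sum_i x i ord0 ^+ 2.

Lemma sqnormE x : sqnorm x = (x^T *m x) ord0 ord0.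
Proof. by rewrite /sqnorm mxE; apply: eq_bigr => i _; rewrite mxE expr2. Qed.

Lemma coord_le_norm x i : `|x i ord0| <= `|x|.
Proof.
rewrite [leRHS]/Num.norm /= mx_normrE.
exact: (le_bigmax _ (fun ij : 'I_d * 'I_1 => `|x ij.1 ij.2|) (i, ord0)).
Qed.

Lemma norm_sq_le_sqnorm x : `|x| ^+ 2 <= sqnorm x.
Proof.
have s0 : 0 <= sqnorm x by apply: sumr_ge0 => i _; exact: sqr_ge0.
have [->|] := eqVneq `|x| 0; first by rewrite expr2 mulr0.
move=> /(@mx_norm_neq0 _ _ _ x)[[i j] /= xij].
rewrite [X in X ^+ 2](xij : `|x| = _) (ord1 j) real_normK ?num_real//.
by rewrite /sqnorm (bigD1 i)//= lerDl sumr_ge0// => k _; exact: sqr_ge0.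
Qed.

Lemma sqnorm_le_norm_sq x : sqnorm x <= d%:R * `|x| ^+ 2.
Proof.
have -> : d%:R * `|x| ^+ 2 = \sum_(i < d) `|x| ^+ 2.
  by rewrite sumr_const card_ord mulr_natl.
apply: ler_sum => i _; rewrite -[x i ord0 ^+ 2]real_normK ?num_real//.
by rewrite lerXn2r ?nnegrE// coord_le_norm.
Qed.

Lemma sqnorm_sim (f : similarity R d) x y :
  sqnorm (f x - f y) = sim_ratio f ^+ 2 * sqnorm (x - y).
Proof.
rewrite /sim_fun opprD addrACA subrr addr0 -scalerBr -mulmxBr.
rewrite !sqnormE -scalemxAr [(_ *: _)^T]linearZ /= -scalemxAl scalerA mxE.
rewrite trmx_mul mulmxA -(mulmxA _ _^T) sim_orthP mulmx1.
by rewrite /sim_ratio real_normK ?num_real// expr2.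
Qed.

Lemma word_map_cat u v : word_map T (u ++ v) = word_map T u \o word_map T v.
Proof. by elim: u => [|i u IH] //=; rewrite IH. Qed.

Lemma word_ratio_cat u v :
  word_ratio T (u ++ v) = word_ratio T u * word_ratio T v.
Proof. by rewrite /word_ratio big_cat. Qed.

Lemma sim_ratio_gt0 (f : similarity R d) : 0 < sim_ratio f.
Proof. by rewrite normr_gt0 sim_lambda_neq0. Qed.

Lemma sim_ratio_lt1 (f : similarity R d) : sim_ratio f < 1.
Proof. by rewrite ltr_norml sim_lambda_bounds. Qed.

Lemma word_ratio_gt0 w : 0 < word_ratio T w.
Proof. by apply: prodr_gt0 => i _; exact: sim_ratio_gt0. Qed.

Lemma sqnorm_word w x y :
  sqnorm (word_map T w x - word_map T w y) =
  word_ratio T w ^+ 2 * sqnorm (x - y).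
Proof.
elim: w => [|i w IH] /=; first by rewrite /word_ratio big_nil expr1n mul1r.
by rewrite sqnorm_sim IH mulrA -exprMn /word_ratio big_cons.
Qed.

Let d_ge1 : 1 <= d%:R :> R. Proof. by rewrite ler1n. Qed.

(** The linear part of a word map is a multiple of an isometry for the
    Euclidean norm only; comparing that norm with the sup norm costs a factor
    which is the same for all words. *)
Lemma word_lipschitz w x y :
  `|word_map T w x - word_map T w y| <= d%:R * word_ratio T w * `|x - y|.
Proof.
have c0 := word_ratio_gt0 w.
rewrite -(@ler_pXn2r _ 2)// ?nnegrE ?mulr_ge0// ?(ltW c0)//.
apply: (le_trans (norm_sq_le_sqnorm _)); rewrite sqnorm_word.
apply: (@le_trans _ _ (word_ratio T w ^+ 2 * (d%:R * `|x - y| ^+ 2))).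
  by rewrite ler_wpM2l ?sqr_ge0// sqnorm_le_norm_sq.
set c := word_ratio T w; set n := `|x - y|.
have -> : (d%:R * c * n) ^+ 2 = d%:R * (c ^+ 2 * (d%:R * n ^+ 2)) by ring.
by rewrite ler_peMl// mulr_ge0 ?sqr_ge0// mulr_ge0 ?sqr_ge0.
Qed.

Lemma word_expand w x y :
  word_ratio T w * `|x - y| <= d%:R * `|word_map T w x - word_map T w y|.
Proof.
have c0 := word_ratio_gt0 w.
rewrite -(@ler_pXn2r _ 2)// ?nnegrE ?mulr_ge0// ?(ltW c0)//.
rewrite exprMn; apply: (@le_trans _ _ (word_ratio T w ^+ 2 * sqnorm (x - y))).
  by rewrite ler_wpM2l ?sqr_ge0// norm_sq_le_sqnorm.
rewrite -sqnorm_word; apply: (le_trans (sqnorm_le_norm_sq _)).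
by rewrite exprMn ler_wpM2r ?sqr_ge0// expr2 ler_peMl.
Qed.

Lemma word_map_inj w : injective (word_map T w).
Proof.
move=> x y fxy; have := word_expand w x y.
rewrite fxy subrr normr0 mulr0 pmulr_rle0 ?word_ratio_gt0// normr_le0.
by rewrite subr_eq0 => /eqP.
Qed.

Lemma word_map_continuous w : continuous (word_map T w).
Proof.
move=> x; apply/(@cvg_ballP _ _ _ _ (nbhs_filter x)) => e e0.
have C0 : 0 < d%:R * word_ratio T w.
  by rewrite mulr_gt0 ?word_ratio_gt0// (lt_le_trans _ d_ge1).
have := nbhsx_ballx x (e / (d%:R * word_ratio T w)) (divr_gt0 e0 C0).
apply: (@filterS _ _ (nbhs_filter x)) => y; rewrite -!ball_normE /= => xy.
apply: (le_lt_trans (word_lipschitz _ _ _)).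
by rewrite mulrC -ltr_pdivlMr.
Qed.

Lemma ratio_bounds : exists a b : R,
  [/\ 0 < a, a < 1, 0 < b, b < 1 & forall i, a <= sim_ratio (T i) <= b].
Proof.
(* The value [1/2] keeps both extrema inside the open unit interval. *)
exists (\big[Order.min/(1/2)]_i sim_ratio (T i)),
       (\big[Order.max/(1/2)]_i sim_ratio (T i)).
have h : (1/2 : R) < 1 by lra.
split.
- by apply/bigmin_gtP; split => [|i _]; [lra|exact: sim_ratio_gt0].
- apply: (le_lt_trans _ h); exact: bigmin_le_id.
- by apply: (@lt_le_trans _ _ (1/2)); [lra|exact: bigmax_ge_id].
- by apply/bigmax_ltP; split => // i _; exact: sim_ratio_lt1.
- by move=> i; rewrite bigmin_le /= ?le_bigmax//; exact: (bigmin_le_cond _ i).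
Qed.

End Words.

(** * Logarithmic orders at the origin *)

Section LogOrder.
Variable R : realType.
Implicit Types (r e : R) (x y : \bar R).

Lemma near_right0P (P : R -> Prop) : (\forall r \near 0^'+, P r) ->
  exists2 r0, 0 < r0 < 1 & forall r, 0 < r -> r < r0 -> P r.
Proof.
move=> /nbhs_ballP[r0 /= r00 H]; exists (Num.min r0 (1/2)).
  by rewrite lt_min r00 gt_min; apply/andP; split; [lra|apply/orP; right; lra].
move=> r r_gt0; rewrite lt_min => /andP[rr0 _]; apply: H => //.
by rewrite -ball_normE /= sub0r normrN gtr0_norm.
Qed.

(** As [ln r] is negative, dividing by it exchanges the two infinite values, in
    accordance with the value of [lne] at [0]. *)
Lemma ln_quotient_lt r e y : 0 < r -> r < 1 ->
  (y / (ln r)%:E < e%:E)%E = ((e * ln r)%:E < y)%E.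
Proof.
move=> r0 r1; have lnr : ln r < 0 by rewrite ln_lt0// r0.
rewrite inver lt_eqF//; case: y => [y| |].
- by rewrite -EFinM !lte_fin ltr_ndivrMr.
- by rewrite lt0_mulye ?lte_fin ?invr_lt0// ltNyr ltry.
- by rewrite lt0_mulNye ?lte_fin ?invr_lt0// !ltNge leey leNye.
Qed.

Lemma lt_ln_quotient r e y : 0 < r -> r < 1 ->
  (e%:E < y / (ln r)%:E)%E = (y < (e * ln r)%:E)%E.
Proof.
move=> r0 r1; have lnr : ln r < 0 by rewrite ln_lt0// r0.
rewrite inver lt_eqF//; case: y => [y| |].
- by rewrite -EFinM !lte_fin ltr_ndivlMr.
- by rewrite lt0_mulye ?lte_fin ?invr_lt0// !ltNge leey leNye.
- by rewrite lt0_mulNye ?lte_fin ?invr_lt0// ltry ltNyr.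
Qed.

Lemma le_powR_of_log_order r e x : 0 < r -> r < 1 ->
  (e%:E < lne x / (ln r)%:E)%E -> (x <= (r `^ e)%:E)%E.
Proof.
move=> r0 r1; rewrite lt_ln_quotient//; case: x => [x| |] //=; last by rewrite leNye.
rewrite lee_fin; case: ifPn => [x0 _|].
  by apply: (le_trans x0); exact: powR_ge0.
rewrite -ltNge lte_fin -ln_powR => x0; rewrite ltr_ln ?posrE ?powR_gt0//.
exact: ltW.
Qed.

Lemma ge_powR_of_log_order r e x : 0 < r -> r < 1 ->
  (lne x / (ln r)%:E < e%:E)%E -> ((r `^ e)%:E <= x)%E.
Proof.
move=> r0 r1; rewrite ln_quotient_lt//; case: x => [x| |] //=; last by rewrite leey.
rewrite lee_fin; case: ifPn => //; rewrite -ltNge lte_fin -ln_powR => x0.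
by rewrite ltr_ln ?posrE ?powR_gt0// => /ltW.
Qed.

Lemma lower_log_order_gt (eta : R -> R) e : (e%:E < lower_log_order eta)%E ->
  exists2 r0, 0 < r0 < 1 & forall r, 0 < r -> r < r0 -> eta r <= r `^ e.
Proof.
rewrite /lower_log_order limf_einfE => /ereal_sup_gt[_ [V V0 <-] eV].
have [r0 r01 H] := near_right0P V0; exists r0 => // r r_gt0 rr0.
rewrite -lee_fin; apply: le_powR_of_log_order => //.
  by case/andP: r01 => _; exact: lt_trans.
by apply: (lt_le_trans eV); apply: ereal_inf_lbound; exists r => //; exact: H.
Qed.

Lemma lower_log_order_lt (eta : R -> R) e : (lower_log_order eta < e%:E)%E ->
  forall r0, 0 < r0 -> exists r, [/\ 0 < r, r < r0 & r `^ e <= eta r].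
Proof.
rewrite /lower_log_order limf_einfE => He r0 r00.
pose V := [set r : R | 0 < r < Num.min r0 1].
have V0 : (0 : R)^'+ V.
  apply/nbhs_ballP; exists (Num.min r0 1) => /=; first by rewrite lt_min r00 ltr01.
  move=> r; rewrite -ball_normE /= sub0r normrN /V /= => + r_gt0.
  by rewrite gtr0_norm// r_gt0.
have : (ereal_inf [set (lne (eta r)%:E / (ln r)%:E)%E | r in V] < e%:E)%E.
  by apply: le_lt_trans He; apply: ereal_sup_ubound; exists V.
move=> /ereal_inf_lt[_ [r Vr <-] Hr].
move: Vr; rewrite /V /= lt_min => /and3P[r_gt0 rr0 r1].
by exists r; split => //; rewrite -lee_fin; exact: ge_powR_of_log_order.
Qed.

(** The separation condition in the form of a subpolynomial bound, uniform over
    the centers of the balls. *)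
Lemma awsc_maps_near d m (T : 'I_m -> similarity R d) (K : set 'cV[R]_d) e :
  AWSC T K -> 0 < e ->
  exists2 r0, 0 < r0 < 1 & forall r (p : 'cV[R]_d), 0 < r -> r < r0 -> K p ->
    (counting (maps_near T K r p) <= (r `^ (- e))%:E)%E.
Proof.
move=> awsc e0.
have e0N : ((- e)%:E < 0)%E by rewrite lte_fin oppr_lt0.
have := awsc _ (open_ereal_gt' e0N).
move=> /near_right0P[r0 r01 H]; exists r0 => // r p r_gt0 rr0 Kp.
apply: (@le_trans _ _ (ereal_sup [set counting (maps_near T K r x) | x in K])).
  by apply: ereal_sup_ubound; exists p.
apply: le_powR_of_log_order => //; last exact: H.
by case/andP: r01 => _; exact: lt_trans.
Qed.

End LogOrder.

(** * Hausdorff measure and dimension *)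

Section Hausdorff.
Variables (R : realType) (d : nat).
Implicit Types (A E U : set 'cV[R]_d) (t s : R).

Lemma ediam_le A (M : R) :
  (forall x y, A x -> A y -> `|x - y| <= M) -> (ediam A <= M%:E)%E.
Proof.
by move=> AM; apply: ge_ereal_sup => _ [x Ax [y Ay <-]]; rewrite lee_fin AM.
Qed.

Lemma le_ediam A x y : A x -> A y -> (`|x - y|%:E <= ediam A)%E.
Proof. by move=> Ax Ay; apply: ereal_sup_ubound; exists x => //; exists y. Qed.

Lemma le_diam A (M : R) x y : (forall x y, A x -> A y -> `|x - y| <= M) ->
  A x -> A y -> `|x - y| <= diam A.
Proof.
move=> /ediam_le AM Ax Ay; have xyA := le_ediam Ax Ay.
rewrite -lee_fin fineK// fin_numElt (lt_le_trans _ xyA) ?ltNyr//=.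
by rewrite (le_lt_trans AM) ?ltry.
Qed.

Lemma diam_le A (M : R) : A !=set0 ->
  (forall x y, A x -> A y -> `|x - y| <= M) -> diam A <= M.
Proof.
move=> [x Ax] /ediam_le AM; have xA := le_ediam Ax Ax.
rewrite -lee_fin fineK// fin_numElt (lt_le_trans _ xA) ?ltNyr//=.
by rewrite (le_lt_trans AM) ?ltry.
Qed.

Lemma hausdorff_gauge_ge0 t U : (0 <= hausdorff_gauge t U)%E.
Proof. by rewrite /hausdorff_gauge; case: ifP => // _; exact: poweR_ge0. Qed.

Lemma ediam_ge0 U : U !=set0 -> (0 <= ediam U)%E.
Proof.
by move=> [x Ux]; have := le_ediam Ux Ux; rewrite subrr normr0.
Qed.

Lemma hausdorff_gauge_le t U (M : R) : 0 <= t -> 0 <= M ->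
  (forall x y, U x -> U y -> `|x - y| <= M) ->
  (hausdorff_gauge t U <= (M `^ t)%:E)%E.
Proof.
move=> t0 M0 /ediam_le UM; rewrite /hausdorff_gauge; case: ifPn => [_|].
  by rewrite lee_fin powR_ge0.
move=> /set0P/ediam_ge0 U0; rewrite -poweR_EFin; apply: gt0_ler_poweR => //.
  by rewrite in_itv /= U0 leey.
by rewrite in_itv /= lee_fin M0 leey.
Qed.

Lemma hausdorff_measure_ge0 t A : (0 <= hausdorff_measure t A)%E.
Proof.
apply: le_ereal_sup_tmp; exists (hausdorff_premeasure t 1 A).
  by exists 1 => //=.
apply: le_ereal_inf_tmp => _ [U _ <-]; apply: nneseries_ge0 => i _ _.
exact: hausdorff_gauge_ge0.
Qed.

Lemma hausdorff_measure_eq0 t A :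
  (forall e, 0 < e -> exists U : nat -> set 'cV[R]_d,
    [/\ A `<=` \bigcup_i U i, forall i, (ediam (U i) <= e%:E)%E &
      (\sum_(0 <= i <oo) hausdorff_gauge t (U i) <= e%:E)%E]) ->
  hausdorff_measure t A = 0%E.
Proof.
move=> H; apply/eqP; rewrite eq_le hausdorff_measure_ge0 andbT.
apply: ge_ereal_sup => _ [e /= e0 <-]; apply/lee_addgt0Pr => e' e'0.
rewrite add0e; have [U [AU Ue Us]] : exists U : nat -> set 'cV[R]_d,
    [/\ A `<=` \bigcup_i U i, forall i, (ediam (U i) <= e%:E)%E &
      (\sum_(0 <= i <oo) hausdorff_gauge t (U i) <= e'%:E)%E].
  have [|U [AU Ue Us]] := H (Num.min e e'); first by rewrite lt_min e0.
  exists U; split => //.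
    by move=> i; apply: (le_trans (Ue i)); rewrite lee_fin ge_min lexx.
  by apply: (le_trans Us); rewrite lee_fin ge_min lexx orbT.
apply: ge_ereal_inf; eexists; last exact: Us.
by exists U => //.
Qed.

Lemma hausdorff_measure_mono t A E : A `<=` E ->
  (hausdorff_measure t A <= hausdorff_measure t E)%E.
Proof.
move=> AE; apply: ge_ereal_sup => _ [e /= e0 <-]; apply: le_ereal_sup_tmp.
exists (hausdorff_premeasure t e E); first by exists e.
apply: ereal_inf_le_tmp => _ [U [EU Ue] <-]; exists U => //; split => //.
exact: subset_trans EU.
Qed.

Lemma nneseries_pair (a : nat -> nat -> \bar R)
    (f : {bij [set: nat] >-> [set: nat * nat]}) :
  (forall i j, 0 <= a i j)%E ->
  (\sum_(0 <= n <oo) a (f n).1 (f n).2 =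
   \sum_(0 <= i <oo) \sum_(0 <= j <oo) a i j)%E.
Proof.
move=> a0; transitivity (\esum_(l in [set: nat] `*` [set: nat]) a l.1 l.2)%E.
  rewrite (reindex_esum [set: nat] _ f)//; last first.
    have := @bijTT _ _ f.
    by rewrite -setTT_bijective/= -[in X in set_bij _ X _ -> _](@setXTT nat nat).
  by rewrite nneseries_esumT//.
rewrite (_ : _ `*` _ = setT `*`` (fun=> setT)); last by apply/seteqP; split.
rewrite -esum_esum// nneseries_esumT => [|i]; last exact: nneseries_ge0.
by apply: eq_esum => i _; rewrite nneseries_esumT.
Qed.

Lemma nneseries_le (a : nat -> \bar R) (M : \bar R) : (forall i, 0 <= a i)%E ->
  (forall n, \sum_(0 <= i < n) a i <= M)%E -> (\sum_(0 <= i <oo) a i <= M)%E.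
Proof.
move=> a0 aM; apply: lime_le; first by apply: is_cvg_nneseries => i _ _.
exact: nearW.
Qed.

(** The first half of the Borel-Cantelli lemma for Hausdorff measures: a set
    whose points lie in infinitely many of countably many balls is null as soon
    as the sum of the [t]-th powers of the diameters converges. *)
Lemma hausdorff_cantelli t A (P : nat -> seq 'cV[R]_d) (rho : nat -> R) (C q : R) :
  0 < t -> (forall j, 0 <= rho j) -> 0 <= q -> q < 1 ->
  (forall j, (size (P j))%:R * (2 * rho j) `^ t <= C * q ^+ j) ->
  (forall e, 0 < e -> exists J, forall j, (J <= j)%N -> rho j <= e) ->
  (forall y, A y -> forall J,
     exists2 j, (J <= j)%N & exists2 p, p \in P j & `|y - p| <= rho j) ->
  hausdorff_measure t A = 0%E.
Proof.
move=> t0 rho0 q0 q1 HP rho_small HA.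
have C0 : 0 <= C.
  have := HP 0%N; rewrite expr0 mulr1; apply: le_trans.
  by rewrite mulr_ge0// powR_ge0.
apply: hausdorff_measure_eq0 => e e0.
have [J1 HJ1] : exists J, forall j, (J <= j)%N -> rho j <= e / 2.
  by apply: rho_small; rewrite divr_gt0.
have q10 : 0 < 1 - q by rewrite subr_gt0.
have [J2 HJ2] : exists J, C * q ^+ J <= e * (1 - q).
  have [J HJ] := expr_small q0 q1 (divr_gt0 (mulr_gt0 e0 q10) (ltr_pwDr ltr01 C0)).
  exists J; have := ltW (HJ J (leqnn _)); rewrite ler_pdivlMr ?ltr_pwDr//.
  apply: le_trans; rewrite mulrC ler_wpM2l ?exprn_ge0//; lra.
pose J := maxn J1 J2.
have HJ : C * q ^+ J <= e * (1 - q).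
  apply: le_trans HJ2; rewrite ler_wpM2l//; apply: ler_wiXn2l => //.
    exact: ltW.
  exact: leq_maxr.
(* [f] enumerates the pairs (scale, position in the list); the finite lists
   are padded with empty sets. *)
pose V i l : set 'cV[R]_d :=
  if (l < size (P (J + i)%N))%N then
    [set y | `|y - nth 0 (P (J + i)%N) l| <= rho (J + i)%N] else set0.
have Vdiam i l x y : V i l x -> V i l y -> `|x - y| <= 2 * rho (J + i)%N.
  rewrite /V; case: ifP => //= _ Hx Hy.
  rewrite -(subrK (nth 0 (P (J + i)%N) l) x) -addrA.
  apply: (le_trans (ler_normD _ _)); rewrite (distrC _ y); lra.
have /card_esym/ppcard_eqP[f] := card_nat2.
exists (fun n => V (f n).1 (f n).2); split.
- move=> y /HA/(_ J)[j Jj [p pP yp]].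
  exists (f^-1%FUN ((j - J)%N, index p (P j))) => //=.
  rewrite invK ?inE//= /V subnKC// index_mem pP /=.
  by rewrite nth_index.
- move=> i; apply: ediam_le => x y Vx Vy; apply: (le_trans (Vdiam _ _ _ _ Vx Vy)).
  rewrite mulrC -ler_pdivlMr// HJ1//.
  by rewrite (leq_trans (leq_maxl _ _) (leq_addr _ _)).
rewrite (nneseries_pair (a := fun i l => hausdorff_gauge t (V i l))); last first.
  by move=> i l; exact: hausdorff_gauge_ge0.
apply: nneseries_le => [i|n].
  by apply: nneseries_ge0 => l _ _; exact: hausdorff_gauge_ge0.
apply: (@le_trans _ _ (\sum_(0 <= i < n) (C * q ^+ J * q ^+ i)%:E)%E).
  apply: lee_sum => i _; rewrite -mulrA -exprD.
  set s := size (P (J + i)%N); set g := (2 * rho (J + i)%N) `^ t.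
  have g0 : 0 <= g by exact: powR_ge0.
  apply: (@le_trans _ _ (s%:R * g)%:E); last by rewrite lee_fin HP.
  apply: nneseries_le => [l|k]; first exact: hausdorff_gauge_ge0.
  suff : (\sum_(0 <= l < k) hausdorff_gauge t (V i l) <= ((minn k s)%:R * g)%:E)%E.
    by move=> /le_trans; apply; rewrite lee_fin ler_wpM2r// ler_nat geq_minr.
  elim: k => [|k IH]; first by rewrite big_geq// min0n mul0r.
  rewrite big_nat_recr//=; have [ks|sk] := ltnP k s.
    rewrite (minn_idPl ks) -natr1 mulrDl mul1r EFinD.
    apply: leeD; first by rewrite (minn_idPl (ltnW ks)) in IH.
    by apply: hausdorff_gauge_le; [exact: ltW|exact: mulr_ge0|exact: Vdiam].
  rewrite /V -/s ltnNge sk /hausdorff_gauge eqxx adde0.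
  by rewrite (minn_idPr (leqW sk)); rewrite (minn_idPr sk) in IH.
rewrite sumEFin lee_fin -mulr_sumr -(ler_pM2r q10).
apply: le_trans HJ; rewrite -mulrA ler_piMr ?mulr_ge0 ?exprn_ge0//.
by rewrite mulrC big_mkord -opprB mulNr -subrX1 opprB gerBl exprn_ge0.
Qed.

Lemma hausdorff_dim_ge0 E : (0 <= hausdorff_dim E)%E.
Proof. by apply: le_ereal_inf_tmp => _ [s [s0 _] <-]; rewrite lee_fin. Qed.

Lemma hausdorff_dim_le t E : 0 <= t -> hausdorff_measure t E = 0%E ->
  (hausdorff_dim E <= t%:E)%E.
Proof. by move=> t0 Et; apply: ereal_inf_lbound; exists t. Qed.

Lemma le_hausdorff_dim t E :
  (forall s, 0 <= s -> s < t -> hausdorff_measure s E <> 0%E) ->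
  (t%:E <= hausdorff_dim E)%E.
Proof.
move=> Ht; apply: le_ereal_inf_tmp => _ [s [s0 Es] <-].
by rewrite lee_fin leNgt; apply/negP => st; exact: (Ht s).
Qed.

Lemma hausdorff_dim_mono A E : A `<=` E ->
  (hausdorff_dim A <= hausdorff_dim E)%E.
Proof.
move=> AE; apply: ereal_inf_le_tmp => _ [s [s0 Es] <-]; exists s => //; split=> //.
apply/eqP; rewrite eq_le hausdorff_measure_ge0 andbT -Es.
exact: hausdorff_measure_mono.
Qed.

End Hausdorff.

(** * Cantor sets with prescribed letters *)

Section Tree.
Variables (R : realType) (A : finType) (a0 : A) (free : nat -> bool).
Implicit Types (p s : seq A) (sigma tau : nat -> A).

Definition free_count (k : nat) : nat := \sum_(0 <= j < k) free j.

(** The mass of a cylinder of depth [k] when the mass splits evenly at the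
    free positions. *)
Definition cylinder_mass (k : nat) : R := (#|A|%:R)^-1 ^+ free_count k.

Definition admissible sigma : Prop := forall j, ~~ free j -> sigma j = a0.

Let A0 : (0 < #|A|)%N. Proof. by apply/card_gt0P; exists a0. Qed.

Lemma cylinder_mass0 : cylinder_mass 0 = 1.
Proof. by rewrite /cylinder_mass /free_count big_geq. Qed.

Lemma cylinder_mass_gt0 k : 0 < cylinder_mass k.
Proof. by rewrite exprn_gt0// invr_gt0 ltr0n. Qed.

Lemma cylinder_massS k :
  cylinder_mass k.+1 = cylinder_mass k * (if free k then #|A|%:R^-1 else 1).
Proof.
rewrite /cylinder_mass /free_count big_nat_recr//= exprD.
by case: (free k); rewrite ?expr1 ?expr0.
Qed.

Definition compatible p s := prefix p s || prefix s p.

(** The mass of the intersection of two cylinders, which is the smaller one or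
    empty. *)
Definition meet_mass p s : R :=
  if compatible p s then cylinder_mass (maxn (size p) (size s)) else 0.

Let meet_mass_ge0 p s : 0 <= meet_mass p s.
Proof. by rewrite /meet_mass; case: ifP => // _; exact/ltW/cylinder_mass_gt0. Qed.

Let compatible_rcons p s a : compatible p (rcons s a) -> compatible p s.
Proof.
rewrite /compatible => /orP[|/prefixP[r ->]]; last first.
  by rewrite cat_rcons prefix_prefix orbT.
case/prefixP => r; case/lastP: r => [|r b].
  by rewrite cats0 => <-; rewrite prefix_rcons orbT.
by rewrite -rcons_cat => /rcons_inj[-> _]; rewrite prefix_prefix.
Qed.

Let meet_mass_long p s a b r :
  p = s ++ b :: r -> meet_mass p (rcons s a) =
  if a == b then meet_mass p s else 0.
Proof.
move=> ->; rewrite /meet_mass /compatible prefix_prefix orbT size_cat size_rcons /=.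
have -> : prefix (rcons s a) (s ++ b :: r) = (a == b).
  by rewrite -cats1 prefix_catr// eqxx /= prefix0s andbT.
have -> : prefix (s ++ b :: r) (rcons s a) = (a == b) && (r == [::]).
  by rewrite -cats1 prefix_catr// eqxx /= [b == a]eq_sym; case: (r).
case: eqP => //= _; rewrite orbT; congr cylinder_mass; lia.
Qed.

Let sum_meet_mass p s : free (size s) ->
  \sum_a meet_mass p (rcons s a) <= meet_mass p s.
Proof.
move=> fs; have [cps|ncps] := boolP (compatible p s); last first.
  rewrite big1// => a _; rewrite /meet_mass.
  by case: ifP => // /compatible_rcons; rewrite (negbTE ncps).
have [ps|nps] := boolP (prefix p s).
  have le_ps : (size p <= size s)%N by exact: size_prefix.
  rewrite (eq_bigr (fun=> cylinder_mass (size s).+1)) => [|a _].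
    rewrite sumr_const -mulr_natl cylinder_massS fs mulrCA divff ?mulr1.
      by rewrite /meet_mass cps (maxn_idPr le_ps).
    by rewrite pnatr_eq0 -lt0n.
  rewrite /meet_mass /compatible (prefix_trans ps (prefix_rcons _ _)).
  by rewrite size_rcons (maxn_idPr (leqW le_ps)).
have : prefix s p by move: cps; rewrite /compatible (negbTE nps).
case/prefixP => -[|b r] pE; first by rewrite pE cats0 prefix_refl in nps.
rewrite (eq_bigr (fun a => if a == b then meet_mass p s else 0)) => [|a _].
  by rewrite -big_mkcond big_pred1_eq.
exact: meet_mass_long pE.
Qed.

Let meet_mass_fixed p s a : ~~ free (size s) ->
  meet_mass p (rcons s a) <= meet_mass p s.
Proof.
move=> fs; have [cps|ncps] := boolP (compatible p s); last first.
  rewrite {1}/meet_mass; case: ifP => // /compatible_rcons.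
  by rewrite (negbTE ncps).
have [ps|nps] := boolP (prefix p s).
  have le_ps : (size p <= size s)%N by exact: size_prefix.
  rewrite /meet_mass cps /compatible (prefix_trans ps (prefix_rcons _ _)).
  rewrite size_rcons (maxn_idPr (leqW le_ps)) (maxn_idPr le_ps) cylinder_massS.
  by rewrite (negbTE fs) mulr1.
have : prefix s p by move: cps; rewrite /compatible (negbTE nps).
case/prefixP => -[|b r] pE; first by rewrite pE cats0 prefix_refl in nps.
by rewrite (meet_mass_long a pE); case: ifP.
Qed.

(** If the total mass is less than one, a sequence outside all the cylinders is
    found letter by letter: as masses add up over the children of a prefix, some
    child is covered by the cylinders to an extent less than its own mass
    whenever the prefix is. A prefix which is one of the cylinders would be
    covered entirely. *)
Lemma cylinder_cover (p : nat -> seq A) :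
  (forall sigma, admissible sigma -> exists i, mkseq sigma (size (p i)) = p i) ->
  (1 <= \sum_(0 <= i <oo) (cylinder_mass (size (p i)))%:E)%E.
Proof.
move=> Hp; rewrite leNgt; apply/negP => sum_lt1.
pose S s := (\sum_(0 <= i <oo) (meet_mass (p i) s)%:E)%E.
have step s : (S s < (cylinder_mass (size s))%:E)%E -> exists a,
    (~~ free (size s) -> a = a0) /\
    (S (rcons s a) < (cylinder_mass (size s).+1)%:E)%E.
  move=> Ss; have [fs|nfs] := boolP (free (size s)); last first.
    exists a0; split=> //; rewrite cylinder_massS (negbTE nfs) mulr1.
    apply: le_lt_trans Ss; apply: lee_nneseries => i *; rewrite lee_fin.
      exact: meet_mass_ge0.
    exact: meet_mass_fixed.
  apply: contrapT => /forallNP Hn.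
  have {}Hn a : ((cylinder_mass (size s).+1)%:E <= S (rcons s a))%E.
    by rewrite leNgt; apply/negP => ?; exact: (Hn a).
  have : ((cylinder_mass (size s))%:E <= S s)%E; last by rewrite leNgt Ss.
  apply: (@le_trans _ _ (\sum_(a : A) (cylinder_mass (size s).+1)%:E)%E).
    rewrite sumEFin lee_fin sumr_const -mulr_natl cylinder_massS fs mulrCA.
    by rewrite divff ?mulr1// pnatr_eq0 -lt0n.
  apply: (@le_trans _ _ (\sum_(a : A) S (rcons s a))%E).
    by apply: lee_sum => a _; exact: Hn.
  rewrite -nneseries_sum; last by move=> a j _; rewrite lee_fin.
  apply: lee_nneseries => i *; first by rewrite sume_ge0// => a _; rewrite lee_fin.
  by rewrite sumEFin lee_fin; exact: sum_meet_mass.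
have [f Hf] : exists f : seq A -> A, forall s,
    (S s < (cylinder_mass (size s))%:E)%E -> (~~ free (size s) -> f s = a0) /\
    (S (rcons s (f s)) < (cylinder_mass (size s).+1)%:E)%E.
  suff [f Hf] : {f : seq A -> A & forall s,
      (S s < (cylinder_mass (size s))%:E)%E -> (~~ free (size s) -> f s = a0) /\
      (S (rcons s (f s)) < (cylinder_mass (size s).+1)%:E)%E} by exists f.
  apply: (@choice _ _ (fun s a => (S s < (cylinder_mass (size s))%:E)%E ->
      (~~ free (size s) -> a = a0) /\
      (S (rcons s a) < (cylinder_mass (size s).+1)%:E)%E)) => s.
  have [/step[a Ha]|nSs] := pselect (S s < (cylinder_mass (size s))%:E)%E.
    by exists a.
  by exists a0.
pose pre := fix pre n := if n is n'.+1 then rcons (pre n') (f (pre n')) else [::].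
pose sigma n := f (pre n).
have preE n : mkseq sigma n = pre n.
  by elim: n => // n IH; rewrite mkseqS IH.
have size_pre n : size (pre n) = n by rewrite -preE size_mkseq.
have preS n : (S (pre n) < (cylinder_mass n)%:E)%E.
  elim: n => [|n IH].
    rewrite cylinder_mass0; apply: le_lt_trans sum_lt1.
    apply: lee_nneseries => i *; first by rewrite lee_fin.
    by rewrite lee_fin /meet_mass /compatible prefix0s orbT maxn0.
  by have := Hf (pre n); rewrite size_pre => /(_ IH)[_].
have [|i Hi] := Hp sigma.
  by move=> j fj; have := Hf (pre j); rewrite size_pre => /(_ (preS j))[/(_ fj)].
have := preS (size (p i)); rewrite ltNge => /negP; apply.
rewrite -preE Hi /S.
apply: (@le_trans _ _ (\sum_(0 <= j < i.+1) (meet_mass (p j) (p i))%:E)%E).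
  rewrite big_nat_recr//= {2}/meet_mass /compatible prefix_refl maxnn.
  by rewrite leeDr// sume_ge0// => j _; rewrite lee_fin.
by apply: nneseries_lim_ge => j _ _; rewrite lee_fin.
Qed.

Lemma first_difference sigma tau k : mkseq sigma k != mkseq tau k ->
  exists j, [/\ (j < k)%N, forall i, (i < j)%N -> sigma i = tau i &
    sigma j != tau j].
Proof.
elim: k => [|k IH]; first by rewrite eqxx.
have [e|/IH[j [jk Hj st]] _] := eqVneq (mkseq sigma k) (mkseq tau k); last first.
  by exists j; split => //; rewrite ltnS ltnW.
rewrite !mkseqS e eqseq_rcons eqxx /= => st; exists k; split => // i ik.
by rewrite -(nth_mkseq a0 sigma ik) e nth_mkseq.
Qed.

(** A set of diameter less than [g j] for all [j < k] meets a single cylinder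
    of depth [k]; hence the diameters of a cover control the masses of a cover
    by cylinders. *)
Lemma cantor_hausdorff (d : nat) (phi : (nat -> A) -> 'cV[R]_d) (g : nat -> R)
    (t C : R) (E : set 'cV[R]_d) :
  0 <= t -> 0 < C -> (forall k, 0 <= g k) ->
  (forall sigma tau k, admissible sigma -> admissible tau ->
    (forall j, (j < k)%N -> sigma j = tau j) -> sigma k != tau k ->
    g k <= `|phi sigma - phi tau|) ->
  (forall k, cylinder_mass k <= C * g k `^ t) ->
  (forall e, 0 < e -> exists k, cylinder_mass k <= e) ->
  (forall sigma, admissible sigma -> E (phi sigma)) ->
  hausdorff_measure t E <> 0%E.
Proof.
move=> t0 C0 g0 sep mass_le mass_small phiE HE.
have : (hausdorff_premeasure t 1 E < (2 * C)^-1%:E)%E.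
  apply: (@le_lt_trans _ _ (hausdorff_measure t E)).
    by apply: ereal_sup_ubound; exists 1 => /=.
  by rewrite HE lte_fin invr_gt0 mulr_gt0.
move=> /ereal_inf_lt[_ [U [EU _] <-] sumU].
have code (V : set 'cV[R]_d) (e : R) : 0 < e -> exists p,
    ((cylinder_mass (size p))%:E <= C%:E * hausdorff_gauge t V + e%:E)%E /\
    forall sigma, admissible sigma -> V (phi sigma) -> mkseq sigma (size p) = p.
  move=> e0; have gauge0 := hausdorff_gauge_ge0 t V.
  have Cgauge0 : (0 <= C%:E * hausdorff_gauge t V)%E by rewrite mule_ge0// lee_fin ltW.
  have [k0 Hk0] := mass_small e e0.
  have [[sigma [s_adm Vs]]|nV] :=
      pselect (exists sigma, admissible sigma /\ V (phi sigma)); last first.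
    exists (nseq k0 a0); rewrite size_nseq; split.
      by apply: (@le_trans _ _ e%:E); rewrite ?lee_fin// leeDr.
    by move=> sigma s_adm Vs; case: nV; exists sigma.
  have V0 : V !=set0 by exists (phi sigma).
  have agree k : (forall j, (j < k)%N -> (ediam V < (g j)%:E)%E) ->
      forall tau, admissible tau -> V (phi tau) -> mkseq tau k = mkseq sigma k.
    move=> Hk tau t_adm Vt; apply/eqP; apply: contrapT => /negP.
    move=> /first_difference[j [jk Hj st]].
    have := Hk j jk; rewrite ltNge => /negP; apply.
    by apply: le_trans (le_ediam Vt Vs); rewrite lee_fin sep.
  have [gV|/forallNP nV] := pselect (exists k, ((g k)%:E <= ediam V)%E).
    case: (ex_minnP gV) => k gk kmin; exists (mkseq sigma k); rewrite size_mkseq.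
    split; last first.
      apply: agree => j jk; rewrite ltNge; apply/negP => /kmin.
      by rewrite leqNgt jk.
    apply: (@le_trans _ _ (C%:E * hausdorff_gauge t V)%E); last first.
      by rewrite leeDl// lee_fin ltW.
    apply: (@le_trans _ _ (C * g k `^ t)%:E); first by rewrite lee_fin.
    rewrite EFinM; apply: lee_wpmul2l; first by rewrite lee_fin ltW.
    rewrite /hausdorff_gauge ifN; last exact/set0P.
    rewrite -poweR_EFin; apply: gt0_ler_poweR => //.
      by rewrite in_itv /= lee_fin g0 leey.
    by rewrite in_itv /= (ediam_ge0 V0) leey.
  exists (mkseq sigma k0); rewrite size_mkseq; split.
    by apply: (@le_trans _ _ e%:E); rewrite ?lee_fin// leeDr.
  by apply: agree => j _; rewrite ltNge; apply/negP/nV.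
pose eps i : R := 4^-1 / (2 ^ i.+1)%:R.
have eps0 i : 0 < eps i by rewrite divr_gt0// ltr0n expn_gt0.
have [p Hp] := choice (fun i => code (U i) (eps i) (eps0 i)).
have : (1 <= \sum_(0 <= i <oo) (cylinder_mass (size (p i)))%:E)%E.
  apply: cylinder_cover => sigma s_adm.
  have [i _ Ui] := EU _ (phiE _ s_adm).
  by exists i; exact: (Hp i).2.
rewrite leNgt => /negP; apply.
apply: (@le_lt_trans _ _ (\sum_(0 <= i <oo) (C%:E * hausdorff_gauge t (U i) + (eps i)%:E))%E).
  apply: lee_nneseries => i *; first by rewrite lee_fin ltW// cylinder_mass_gt0.
  exact: (Hp i).1.
have Cgauge i : (0 <= C%:E * hausdorff_gauge t (U i))%E.
  by rewrite mule_ge0 ?hausdorff_gauge_ge0// lee_fin ltW.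
apply: le_lt_trans (epsilon_trick xpredT Cgauge _) _ => //.
rewrite nneseriesZl; last by move=> i _; exact: hausdorff_gauge_ge0.
apply: (@le_lt_trans _ _ (C%:E * (2 * C)^-1%:E + 4^-1%:E)%E).
  rewrite leeD2r// lee_wpmul2l ?lee_fin//; first exact: ltW.
  exact: ltW.
rewrite -EFinM -EFinD lte_fin invfM mulrCA divff ?gt_eqF// mulr1; lra.
Qed.

End Tree.

(** * Sparse windows of prescribed letters *)

Section Windows.
Variables (R : realType) (n M : nat -> nat) (theta alpha : R).
Hypotheses (alpha_ge0 : 0 <= alpha) (alpha_le1 : alpha <= 1).
Hypotheses (at_ge0 : 0 <= alpha * theta) (at_le1 : alpha * theta <= 1).
Hypothesis n_incr : forall i, (n i < n i.+1)%N.
Hypothesis window_start : forall i, (n i <= M i)%N.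
Hypothesis window_stop : forall i, (M i)%:R <= theta * (n i)%:R.
Hypothesis window_gap : forall i, (M i)%:R <= (1 - alpha * theta) * (n i.+1)%:R.

Definition outside_windows (j : nat) : bool :=
  `[< forall i, ~~ ((n i <= j) && (j < M i))%N >].

Let F := free_count outside_windows.

Let n_mono i j : (i <= j)%N -> (n i <= n j)%N.
Proof. by move=> ij; apply: (homo_leq leqnn leq_trans) => // k; exact/ltnW/n_incr. Qed.

Let M_le_n i : (M i <= n i.+1)%N.
Proof.
rewrite -(ler_nat R); apply: (le_trans (window_gap i)).
by rewrite ler_piMl ?ler0n// gerBl.
Qed.

Let free_run k l : (k <= l)%N ->
  (forall j, (k <= j)%N -> (j < l)%N -> outside_windows j) -> F l = (F k + (l - k))%N.
Proof.
move=> kl free_kl; rewrite /F /free_count (big_cat_nat (n := k))//=; congr addn.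
rewrite (eq_big_nat _ _ (F2 := fun=> 1%N)) ?sum_nat_const_nat ?muln1// => j /andP[kj jl].
by rewrite free_kl.
Qed.

Let free_mono k l : (k <= l)%N -> (F k <= F l)%N.
Proof. by move=> kl; rewrite /F /free_count (big_cat_nat (n := k) _ kl)//=; exact: leq_addr. Qed.

Let before_free k : (k <= n 0)%N -> F k = k.
Proof.
move=> kn; rewrite (@free_run 0)//; first by rewrite /F /free_count big_geq// subn0.
move=> j _ jk; apply/asboolP => i; rewrite negb_and -ltnNge.
by rewrite (leq_trans jk)// (leq_trans kn)// n_mono.
Qed.

Let between_free i k : (M i <= k)%N -> (k <= n i.+1)%N -> F k = (F (M i) + (k - M i))%N.
Proof.
move=> Mk kn; apply: free_run => // j Mj jk; apply/asboolP => i'.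
rewrite negb_and -ltnNge -leqNgt; have [ii|ii] := leqP i' i.
  apply/orP; right; apply: leq_trans Mj; case: (ltngtP i' i) ii => [ii _||->] //.
  by apply: leq_trans (M_le_n _) _; apply: leq_trans (window_start _); exact: n_mono.
by apply/orP; left; apply: (leq_trans jk); apply: (leq_trans kn); exact: n_mono.
Qed.

(** At the start of a window the free positions since the previous window
    already suffice for the whole of it; after a window every position is
    free until the next one. *)
Lemma free_count_windows k : alpha * k%:R <= (F k)%:R.
Proof.
have at_start i : alpha * theta * (n i)%:R <= (F (n i))%:R.
  case: i => [|i]; first by rewrite before_free// ler_piMl ?ler0n.
  rewrite (between_free (M_le_n i))// natrD natrB//.
  have : (0 : R) <= (F (M i))%:R by [].
  by have := window_gap i; lra.
have key i : forall k, (k <= n i)%N -> alpha * k%:R <= (F k)%:R.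
  elim: i => [|i IH] {}k kn; first by rewrite before_free// ler_piMl ?ler0n.
  have [/IH//|nk] := leqP k (n i).
  have in_window l : (n i <= l)%N -> (l <= M i)%N -> alpha * l%:R <= (F l)%:R.
    move=> nl lM; apply: (@le_trans _ _ (F (n i))%:R); last by rewrite ler_nat free_mono.
    apply: le_trans (at_start i); rewrite -mulrA ler_wpM2l//.
    by apply: le_trans (window_stop i); rewrite ler_nat.
  have [kM|Mk] := leqP k (M i); first by apply: in_window => //; exact: ltnW.
  rewrite (between_free (ltnW Mk))// natrD natrB ?(ltnW Mk)//.
  have := in_window (M i) (window_start i) (leqnn _).
  have : (0 : R) <= k%:R - (M i)%:R by rewrite subr_ge0 ler_nat ltnW.
  move=> kM0 HM.
  have : alpha * (k%:R - (M i)%:R) <= k%:R - (M i)%:R by rewrite ler_piMl.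
  by lra.
apply: (key k); elim: (k) => // k' IH; exact: leq_ltn_trans IH (n_incr _).
Qed.

End Windows.

(** The radii [u] at which [eta u] is large need not be among the scales
    [b ^+ n.+1 * e0]. By monotonicity the scale just above [u] is as good up to
    one factor [b], which the inequality [Delta < y * theta] absorbs for [n]
    large. *)
Lemma good_scale (R : realType) (eta : R -> R) (b r e0 C y theta Delta : R) :
  0 < b -> b < 1 -> 0 < r -> r <= b `^ y -> 0 < y -> 0 < e0 -> 0 < C ->
  0 < Delta -> Delta < y * theta ->
  (forall u v, 0 <= u -> u <= v -> eta u <= eta v) ->
  (forall r0, 0 < r0 -> exists u, [/\ 0 < u, u < r0 & u `^ Delta <= eta u]) ->
  forall n0, exists2 n, (n0 <= n)%N &
    C * r ^+ Num.truncn (theta * n%:R) <= eta (b ^+ n.+1 * e0).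
Proof.
move=> b0 b1 r0 rb y0 e00 C0 Delta0 Dyt eta_mono Heta n0.
have q0 : 0 <= b `^ (y * theta - Delta) by exact: powR_ge0.
have q1 : b `^ (y * theta - Delta) < 1.
  by apply: powR_lt1 => //; [exact: ltW|rewrite subr_gt0].
pose c := C^-1 * (b `^ (y + 2 * Delta) * e0 `^ Delta).
have c0 : 0 < c by rewrite !mulr_gt0 ?invr_gt0 ?powR_gt0.
have [N0 HN0] := expr_small q0 q1 c0.
pose N := maxn n0 N0.
have [|u [u0 uN ueta]] := Heta (b ^+ N.+1 * e0); first by rewrite mulr_gt0 ?exprn_gt0.
have [N1 HN1] := expr_small (ltW b0) b1 (divr_gt0 u0 e00).
have ex : exists n, b ^+ n.+2 * e0 < u.
  by exists N1; rewrite -ltr_pdivlMr// HN1// ltnW.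
case: (ex_minnP ex) => n nu nmin.
have un : u <= b ^+ n.+1 * e0.
  case: n {nu} nmin => [|n] nmin; last by rewrite leNgt; apply/negP => /nmin; rewrite ltnn.
  apply: (le_trans (ltW uN)); rewrite ler_wpM2r ?(ltW e00)//.
  by apply: ler_wiXn2l; [exact: ltW|exact: ltW|].
have Nn : (N <= n)%N.
  have : b ^+ n.+2 < b ^+ N.+1 by rewrite -(ltr_pM2r e00) (lt_trans nu).
  by rewrite ltr_iXn2l// !ltnS.
exists n; first exact: leq_trans (leq_maxl _ _) Nn.
apply: le_trans (eta_mono _ _ (ltW u0) un); apply: le_trans ueta.
apply: (@le_trans _ _ ((b ^+ n.+2 * e0) `^ Delta)); last first.
  apply: (ge0_ler_powR (ltW Delta0)); rewrite ?nnegrE ?(ltW u0) ?(ltW nu)//.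
  by rewrite mulr_ge0 ?exprn_ge0 ?(ltW b0) ?(ltW e00).
apply: (@le_trans _ _ (C * b `^ (y * (theta * n%:R - 1)))).
  rewrite ler_pM2l// powRrM.
  set k := Num.truncn _; have kn : theta * n%:R - 1 <= k%:R.
    by rewrite lerBlDr natr1 ltW// truncnS_gt.
  apply: (@le_trans _ _ ((b `^ y) ^+ k)).
    by rewrite lerXn2r ?nnegrE ?powR_ge0 ?(ltW r0).
  rewrite -powR_mulrn ?powR_ge0//; apply: ger_powR => //.
  rewrite powR_gt0//= ltW// powR_lt1// ltW//.
have := ltW (HN0 n (leq_trans (leq_maxr _ _) Nn)).
rewrite /c ler_pdivlMl// -powR_mulrn// -powRrM => H.
rewrite powRM ?exprn_ge0 ?(ltW b0) ?(ltW e00)// -(powR_mulrn n.+2 (ltW b0)).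
rewrite -!powRrM.
have -> : y * (theta * n%:R - 1) = (y * theta - Delta) * n%:R + (Delta * n%:R - y) by ring.
have -> : n.+2%:R * Delta = (y + 2 * Delta) + (Delta * n%:R - y).
  by rewrite -(addn2 n) natrD; ring.
have bD u' v' : b `^ (u' + v') = b `^ u' * b `^ v'.
  by rewrite powRD//; apply/implyP => _; rewrite gt_eqF.
rewrite (bD ((y * theta - Delta) * _)) (bD (y + _)).
by rewrite [leLHS]mulrA [leRHS]mulrAC ler_pM2r ?powR_gt0.
Qed.

(** * The attractor and its pieces *)

Section Attractor.
Variables (R : realType) (d m : nat).
Hypothesis hd : (0 < d)%N.
Variable (T : 'I_m -> similarity R d).
Variable (K : set 'cV[R]_d).
Hypothesis KT : is_attractor T K.
Implicit Types (u v w : seq 'I_m) (x y : 'cV[R]_d).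

Let d_gt0 : 0 < d%:R :> R. Proof. by rewrite ltr0n. Qed.

Lemma attractor_bounded :
  exists2 D : R, 1 <= D & forall x y, K x -> K y -> `|x - y| <= D.
Proof.
case: KT => _ /compact_bounded[M [_ HM]] _.
have KM x : K x -> `|x| <= `|M| + 1.
  by apply: HM; rewrite (le_lt_trans (ler_norm _))// ltrDl.
exists (2 * (`|M| + 1)) => [|x y Kx Ky]; first by have := normr_ge0 M; lra.
by apply: (le_trans (ler_normB _ _)); have := KM _ Kx; have := KM _ Ky; lra.
Qed.

Lemma word_piece_sub w : word_map T w @` K `<=` K.
Proof.
elim: w => [|i w IH] x /=; first by move=> [y Ky <-].
move=> [y Ky <-]; case: KT => _ _ ->; exists i => //=.
by exists (word_map T w y) => //; apply: IH; exists y.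
Qed.

Lemma word_pieces_cover n y : K y ->
  exists2 w, size w = n & (word_map T w @` K) y.
Proof.
elim: n y => [|n IH] y Ky; first by exists [::] => //; exists y.
have : K y by [].
case: KT => _ _ {1}-> [i _] [z Kz <-].
have [w wn [t Kt tz]] := IH z Kz.
by exists (i :: w) => /=; [rewrite wn | exists t => //=; rewrite tz].
Qed.

Lemma word_piece_closed w : closed (word_map T w @` K).
Proof.
apply: compact_closed; first exact: norm_hausdorff.
case: KT => _ Kc _; apply: continuous_compact => //.
by apply: continuous_subspaceT; exact: word_map_continuous.
Qed.

Variables (cmin cmax D : R).
Hypothesis cmin_gt0 : 0 < cmin.
Hypothesis cmin_lt1 : cmin < 1.
Hypothesis cmax_gt0 : 0 < cmax.
Hypothesis cmax_lt1 : cmax < 1.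
Hypothesis ratioP : forall i, cmin <= sim_ratio (T i) <= cmax.
Hypothesis D_ge1 : 1 <= D.
Hypothesis DP : forall x y, K x -> K y -> `|x - y| <= D.

Lemma word_ratio_le w : word_ratio T w <= cmax ^+ size w.
Proof.
elim: w => [|i w IH]; first by rewrite /word_ratio big_nil expr0.
rewrite /word_ratio big_cons exprS ler_pM ?(ltW (sim_ratio_gt0 _))//.
  exact: (ltW (word_ratio_gt0 _ _)).
by case/andP: (ratioP i).
Qed.

Lemma word_ratio_le1 w : word_ratio T w <= 1.
Proof.
by apply: (le_trans (word_ratio_le w)); rewrite exprn_ile1// ltW.
Qed.

Lemma word_piece_diam w x y : (word_map T w @` K) x -> (word_map T w @` K) y ->
  `|x - y| <= d%:R * D * word_ratio T w.
Proof.
move=> [x' Kx <-] [y' Ky <-].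
apply: (le_trans (word_lipschitz hd _ _ _ _)).
rewrite mulrAC; apply: ler_wpM2r; first exact: (ltW (word_ratio_gt0 _ _)).
by rewrite ler_pM2l// DP.
Qed.

Lemma cutset_ratio r w : cutset T r w -> cmin * r < word_ratio T w <= r.
Proof.
case/lastP: w => [|w i]; first by move=> [].
move=> [_]; rewrite size_rcons -cats1 take_size_cat// => /andP[-> rw].
rewrite andbT word_ratio_cat {2}/word_ratio big_seq1 (mulrC cmin).
have [r0|r0] := ltP 0 r; last first.
  apply: (@le_lt_trans _ _ 0); last by rewrite mulr_gt0 ?word_ratio_gt0 ?sim_ratio_gt0.
  by rewrite mulrC pmulr_rle0.
apply: (@lt_le_trans _ _ (word_ratio T w * cmin)); first by rewrite ltr_pM2r.
by rewrite ler_pM2l ?word_ratio_gt0//; case/andP: (ratioP i).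
Qed.

Lemma cutset_prefix r w : r < 1 -> word_ratio T w <= r ->
  exists u v, w = u ++ v /\ cutset T r u.
Proof.
move=> r1; elim/last_ind: w => [|w i IH] wr.
  by move: wr; rewrite /word_ratio big_nil leNgt r1.
have [/IH[u [v [-> cu]]]|rw] := leP (word_ratio T w) r.
  by exists u, (rcons v i); rewrite rcons_cat.
exists (rcons w i), [::]; rewrite cats0; split => //; split.
  by rewrite size_rcons.
by rewrite wr size_rcons -cats1 take_size_cat.
Qed.

Lemma cutset_size r w n : cutset T r w -> cmax ^+ n <= r -> (size w <= n)%N.
Proof.
move=> [w0 /andP[_ rw]] nr; have := le_lt_trans nr (lt_le_trans rw (word_ratio_le _)).
by rewrite size_takel ?leq_pred// ltr_iXn2l// prednK.
Qed.

Lemma cutset_cover r : 0 < r -> r < 1 -> exists L : seq (seq 'I_m),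
  (forall w, w \in L <-> cutset T r w) /\
  forall y, K y -> exists2 w, w \in L & (word_map T w @` K) y.
Proof.
move=> r0 r1; have [N HN] := expr_small (ltW cmax_gt0) cmax_lt1 r0.
have {}HN := ltW (HN N (leqnn _)).
exists [seq w <- short_words m N | `[< cutset T r w >]]; split.
  move=> w; rewrite mem_filter mem_short_words; split => [/andP[/asboolP]//|cw].
  by apply/andP; split; [exact/asboolP | exact: cutset_size cw HN].
move=> y /(word_pieces_cover N)[w wN [x Kx <-]].
have [|u [v [wuv cu]]] := @cutset_prefix r w r1.
  by apply: (le_trans (word_ratio_le _)); rewrite wN.
exists u.
  rewrite mem_filter mem_short_words; apply/andP; split; first exact/asboolP.
  exact: cutset_size cu HN.
rewrite wuv word_map_cat; exists (word_map T v x) => //.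
by apply: word_piece_sub; exists x.
Qed.

(** Every infinite concatenation of non-empty words has a limit point, which
    lies in the pieces of all its prefixes. *)
Lemma nested_limit (b : nat -> seq 'I_m) : (forall i, (0 < size (b i))%N) ->
  exists z, forall n, (word_map T (flatten (mkseq b n)) @` K) z.
Proof.
move=> b0; case: (KT) => -[x0 Kx0] _ _.
pose W n := word_map T (flatten (mkseq b n)).
have WS n k : (W n @` K) (W (n + k)%N x0).
  rewrite /W flatten_mkseqD word_map_cat /=; eexists; last by reflexivity.
  by apply: word_piece_sub; exists x0.
have ratio n : word_ratio T (flatten (mkseq b n)) <= cmax ^+ n.
  apply: (le_trans (word_ratio_le _)); apply: ler_wiXn2l; rewrite ?ltW//.
  exact: size_flatten_mkseq.
have dD : 0 < d%:R * D by rewrite mulr_gt0// (lt_le_trans _ D_ge1).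
have /cauchy_cvgP/cvg_ex[z Wz] : cauchy (W n x0 @[n --> \oo]).
  apply/cauchy_exP => e e0.
  have [N HN] := expr_small (ltW cmax_gt0) cmax_lt1 (divr_gt0 e0 dD).
  exists (W N x0); exists N => // k /= Nk; rewrite -ball_normE /=.
  have := word_piece_diam (WS N 0%N) (WS N (k - N)%N); rewrite addn0 subnKC//.
  move/le_lt_trans; apply; rewrite mulrC -ltr_pdivlMr//.
  by apply: (le_lt_trans (ratio N)); exact: HN.
exists z => n; apply: (closed_cvg (W n @` K) _ _ z Wz).
  exact: word_piece_closed.
by exists n => // k /= nk; have := WS n (k - n)%N; rewrite subnKC.
Qed.

Lemma nested_limit_unique (b : nat -> seq 'I_m) y z :
  (forall i, (0 < size (b i))%N) ->
  (forall n, (word_map T (flatten (mkseq b n)) @` K) y) ->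
  (forall n, (word_map T (flatten (mkseq b n)) @` K) z) -> y = z.
Proof.
move=> b0 Hy Hz; apply/eqP; rewrite -subr_eq0 -normr_le0 leNgt; apply/negP => yz.
have dD : 0 < d%:R * D by rewrite mulr_gt0// (lt_le_trans _ D_ge1).
have [N HN] := expr_small (ltW cmax_gt0) cmax_lt1 (divr_gt0 yz dD).
have := word_piece_diam (Hy N) (Hz N); rewrite leNgt => /negP; apply.
rewrite mulrC -ltr_pdivlMr//.
apply: (le_lt_trans (word_ratio_le _)); apply: (@le_lt_trans _ _ (cmax ^+ N)).
  by apply: ler_wiXn2l; rewrite ?ltW//; exact: size_flatten_mkseq.
exact: HN.
Qed.

(** The approximating points start from [0], which may lie outside [K]; the
    contraction makes them converge to the same limit as those of [K]. *)
Lemma canonical_projP (j : nat -> 'I_m) n :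
  (word_map T (mkseq j n) @` K) (canonical_proj T j).
Proof.
pose b i := [:: j i]; have b0 i : (0 < size (b i))%N by [].
have bE k : flatten (mkseq b k) = mkseq j k.
  by rewrite /mkseq /b; elim: (iota 0 k) => //= i s ->.
have [z Hz] := nested_limit b0.
suff -> : canonical_proj T j = z by rewrite -bE.
apply: cvg_lim; first exact: norm_hausdorff.
case: (KT) => -[x0 Kx0] _ _.
apply/cvg_ballP => e e0.
pose C := d%:R * (D + `|x0|).
have C0 : 0 < C.
  by rewrite mulr_gt0// (@lt_le_trans _ _ D) ?lerDl// (lt_le_trans _ D_ge1).
have [N HN] := expr_small (ltW cmax_gt0) cmax_lt1 (divr_gt0 e0 C0).
exists N => // k /= Nk; rewrite -ball_normE /=.
have [y Ky <-] := Hz k; rewrite bE.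
apply: (le_lt_trans (word_lipschitz hd _ _ _ _)).
apply: (@le_lt_trans _ _ (C * cmax ^+ k)); last first.
  by rewrite mulrC -ltr_pdivlMr// HN.
rewrite mulrAC /C -!mulrA ler_pM2l// ler_pM//; first exact: (ltW (word_ratio_gt0 _ _)).
  rewrite subr0 -(subrK x0 y); apply: (le_trans (ler_normD _ _)).
  by rewrite lerD2r DP.
by apply: (le_trans (word_ratio_le _)); rewrite size_mkseq.
Qed.

Lemma eventually_periodic_prefix (i0 : 'I_m) w k q : (k < size w)%N ->
  mkseq (eventually_periodic i0 w k) (size w + q * (size w - k)) =
  take k w ++ flatten (nseq q.+1 (drop k w)).
Proof.
move=> kw; elim: q => [|q IH].
  rewrite mul0n addn0 /= cats0 cat_take_drop.
  apply: (@eq_from_nth _ i0); rewrite ?size_mkseq// => i iw.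
  by rewrite nth_mkseq// /eventually_periodic iw.
have -> : nseq q.+2 (drop k w) = nseq q.+1 (drop k w) ++ [:: drop k w].
  by rewrite -[[:: _]]/(nseq 1 _) -nseqD addn1.
rewrite flatten_cat catA -IH /= cats0 mulSnr addnA /mkseq iotaD map_cat add0n; congr (_ ++ _).
set N := (size w + _)%N.
apply: (@eq_from_nth _ i0); first by rewrite size_map size_iota size_drop.
rewrite size_map size_iota => i iw.
rewrite (nth_map 0%N) ?size_iota// nth_iota// nth_drop /eventually_periodic.
have -> : (N + i < size w)%N = false by apply/negbTE; rewrite -leqNgt /N -addnA leq_addr.
have -> : (N + i - size w = q * (size w - k) + i)%N by rewrite /N -addnA addKn.
by rewrite modnMDl modn_small.
Qed.

(** The point coded by an eventually periodic sequence is the image under the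
    preperiod of the fixed point of the period. *)
Lemma eventually_periodic_proj (i0 : 'I_m) w k : (k < size w)%N ->
  let z := canonical_proj T (eventually_periodic i0 w k) in
  (forall q, (word_map T (take k w ++ flatten (nseq q (drop k w))) @` K) z) /\
  exists2 p, word_map T (drop k w) p = p & z = word_map T (take k w) p.
Proof.
move=> kw z; set u := take k w; set v := drop k w.
have zq q : (word_map T (u ++ flatten (nseq q v)) @` K) z.
  have := canonical_projP (eventually_periodic i0 w k) (size w + q * (size w - k)).
  rewrite eventually_periodic_prefix// -[q.+1]addn1 nseqD flatten_cat catA.
  rewrite word_map_cat -/u -/v -/z => -[y Ky <-] /=; eexists; last by reflexivity.
  by apply: word_piece_sub; exists y; rewrite //= cats0.
split=> //; have := zq 0%N; rewrite /= cats0 => -[p Kp pz]; exists p => //.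
pose b (i : nat) := v.
have b0 i : (0 < size (b i))%N by rewrite size_drop subn_gt0.
have bE n : flatten (mkseq b n) = flatten (nseq n v).
  by rewrite /mkseq; congr flatten; elim: (n) 0%N => //= n' IH s; rewrite IH.
have pb n : (word_map T (flatten (mkseq b n)) @` K) p.
  have [y Ky] := zq n; rewrite word_map_cat -pz => /word_map_inj-/(_ hd) yp.
  by exists y => //; rewrite bE.
apply: (nested_limit_unique b0) => // -[|n].
  by exists (word_map T v p) => //; apply: word_piece_sub; exists p.
have -> : flatten (mkseq b n.+1) = v ++ flatten (mkseq b n) by rewrite !bE.
by rewrite word_map_cat /=; have [y Ky <-] := pb n; exists y.
Qed.

Variable x0 : 'cV[R]_d.
Hypothesis Kx0 : K x0.

Let dD_gt0 : 0 < d%:R * D.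
Proof. by rewrite mulr_gt0// (lt_le_trans _ D_ge1). Qed.

(** * Separated subsystems *)

Definition piece_size (r : R) : R := d%:R * D * r.

Let piece_size_gt0 r : 0 < r -> 0 < piece_size r.
Proof. exact: mulr_gt0. Qed.

Lemma cutset_piece_diam r w x y : cutset T r w ->
  (word_map T w @` K) x -> (word_map T w @` K) y -> `|x - y| <= piece_size r.
Proof.
move=> /cutset_ratio/andP[_ wr] Hx Hy; apply: (le_trans (word_piece_diam Hx Hy)).
by rewrite ler_pM2l.
Qed.

(** [V] is a maximal family of words of comparable contraction ratio whose
    pieces are far apart relative to their size. *)
Definition separated_family (r : R) (V : seq (seq 'I_m)) : Prop :=
  [/\ uniq V, forall w, w \in V -> cutset T r w,
    forall u v, u \in V -> v \in V -> u != v ->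
      forall x y, (word_map T u @` K) x -> (word_map T v @` K) y ->
      piece_size r <= `|x - y| &
    forall y, K y -> exists2 v, v \in V & `|y - word_map T v x0| <= 4 * piece_size r].

(** The pieces of a cutset have diameter at most [piece_size r]; so centers at
    distance [3 * piece_size r] leave a gap of one [piece_size r] between their
    pieces, and discarding the other pieces enlarges the covering radius from
    [piece_size r] to at most four times that. *)
Lemma separated_family_exists r : 0 < r -> r < 1 ->
  exists V, separated_family r V.
Proof.
move=> r0 r1; have h0 := piece_size_gt0 r0.
have [L [Lcut Lcov]] := cutset_cover r0 r1.
have [|V [uV sV sepV covV]] :=
  @maximal_separated _ _ _ (fun w => word_map T w x0) (3 * piece_size r) L.
  by rewrite mulr_ge0// ltW.
have center w : (word_map T w @` K) (word_map T w x0) by exists x0.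
exists V; split => //.
- by move=> w /sV /Lcut.
- move=> u v uV' vV' uv x y Hx Hy; have := sepV u v uV' vV' uv.
  have := cutset_piece_diam (iffLR (Lcut u) (sV _ uV')) (center u) Hx.
  have := cutset_piece_diam (iffLR (Lcut v) (sV _ vV')) Hy (center v).
  set cu := word_map T u x0; set cv := word_map T v x0 => H1 H2 H3.
  have : `|cu - cv| <= `|cu - x| + `|x - y| + `|y - cv|.
    by rewrite -(subrKA x cu) -(subrKA y x) addrA (le_trans (ler_normD _ _))// lerD2r ler_normD.
  by move=> H4; lra.
- move=> y Ky; have [w wL Hy] := Lcov y Ky; have [v vV wv] := covV w wL.
  exists v => //; have H1 := cutset_piece_diam (iffLR (Lcut w) wL) Hy (center w).
  rewrite -(subrKA (word_map T w x0) y).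
  by apply: (le_trans (ler_normD _ _)); lra.
Qed.

Section Subsystem.
Variables (r : R) (V : seq (seq 'I_m)).
Hypothesis r_gt0 : 0 < r.
Hypothesis V_sep : separated_family r V.

Definition block (a : 'I_(size V)) : seq 'I_m := nth [::] V a.

Definition block_word (sigma : nat -> 'I_(size V)) (n : nat) : seq 'I_m :=
  flatten (mkseq (block \o sigma) n).

Let b := cmin * r.
Let b_gt0 : 0 < b. Proof. exact: mulr_gt0. Qed.

Lemma block_mem a : block a \in V. Proof. by rewrite mem_nth. Qed.

Lemma block_cutset a : cutset T r (block a).
Proof. by case: V_sep => _ + _ _; apply; exact: block_mem. Qed.

Lemma block_size_gt0 a : (0 < size (block a))%N.
Proof. by case: (block_cutset a). Qed.

Lemma block_wordS sigma n :
  block_word sigma n.+1 = block_word sigma n ++ block (sigma n).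
Proof. by rewrite /block_word mkseqS flatten_rcons. Qed.

Lemma block_word_ratio sigma n :
  b ^+ n <= word_ratio T (block_word sigma n) <= r ^+ n.
Proof.
elim: n => [|n /andP[IH1 IH2]].
  by rewrite /block_word /= /word_ratio big_nil !expr0 !lexx.
rewrite block_wordS word_ratio_cat !exprSr.
have /cutset_ratio/andP[H1 H2] := block_cutset (sigma n).
have := word_ratio_gt0 T (block_word sigma n).
have := word_ratio_gt0 T (block (sigma n)).
move=> H3 H4; apply/andP; split; apply: ler_pM => //.
- by rewrite exprn_ge0// ltW.
- exact: ltW.
- exact: ltW.
- exact: ltW.
- exact: ltW.
Qed.

(** The map of the common prefix takes two points of different pieces of the
    family to [y] and [z]. *)
Lemma block_word_separation sigma tau k y z :
  (forall j, (j < k)%N -> sigma j = tau j) -> sigma k != tau k ->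
  (word_map T (block_word sigma k.+1) @` K) y ->
  (word_map T (block_word tau k.+1) @` K) z ->
  b ^+ k * (D * r) <= `|y - z|.
Proof.
move=> st stk.
have wE : block_word tau k = block_word sigma k.
  congr flatten; apply/eq_in_map => j; rewrite mem_iota add0n => /andP[_ jk].
  by rewrite /= st.
rewrite !block_wordS wE !word_map_cat => -[y' Ky <-] [z' Kz <-] /=.
have neq : block (sigma k) != block (tau k).
  by case: V_sep => uV _ _ _; rewrite nth_uniq.
have sep : piece_size r <= `|word_map T (block (sigma k)) y' - word_map T (block (tau k)) z'|.
  case: V_sep => _ _ + _; move=> /(_ _ _ (block_mem _) (block_mem _) neq).
  by apply; [exists y'|exists z'].
have /andP[bk _] := block_word_ratio sigma k.
rewrite -(ler_pM2l d_gt0); apply: le_trans (word_expand hd _ _ _ _).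
rewrite mulrCA mulrA mulrA -mulrA -mulrA [d%:R * _]mulrA.
apply: ler_pM => //; first by rewrite exprn_ge0// ltW.
exact/ltW/piece_size_gt0.
Qed.

(** A subsystem with [size V] maps of ratio at least [b] has similarity
    dimension at least [t2] when [b `^ (- t2) <= size V]; letting a proportion
    [alpha] of the letters vary freely multiplies this by [alpha]. *)
Lemma subsystem_hausdorff (a0 : 'I_(size V)) (free : nat -> bool)
    (alpha t2 t : R) (E : set 'cV[R]_d) :
  r < 1 -> 0 < alpha -> 0 < t2 -> 0 <= t -> t <= alpha * t2 ->
  b `^ (- t2) <= (size V)%:R ->
  (forall k, alpha * k%:R <= (free_count free k)%:R) ->
  (forall sigma z, admissible a0 free sigma ->
    (forall n, (word_map T (block_word sigma n) @` K) z) -> E z) ->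
  hausdorff_measure t E <> 0%E.
Proof.
move=> r1 alpha0 t20 t0 t_le sizeV Fk HE.
have b1 : b < 1 by rewrite mulr_ilt1 ?(ltW cmin_gt0) ?(ltW r_gt0).
have N0 : 0 < (size V)%:R :> R.
  by rewrite ltr0n (leq_ltn_trans _ (ltn_ord a0)).
have mass_le k : cylinder_mass R 'I_(size V) free k <= b `^ (alpha * t2 * k%:R).
  rewrite /cylinder_mass card_ord.
  apply: (@le_trans _ _ ((b `^ t2) ^+ free_count free k)).
    rewrite lerXn2r ?nnegrE ?invr_ge0 ?ler0n ?powR_ge0//.
    by rewrite -[leRHS]invrK lef_pV2 ?posrE ?invr_gt0 ?powR_gt0// -powRN.
  rewrite -powR_mulrn ?powR_ge0// -powRrM; apply: ger_powR.
    by rewrite b_gt0 ltW.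
  by rewrite mulrAC [alpha * _ * _]mulrC ler_pM2l.
have Dr : 0 < D * r by rewrite mulr_gt0// (lt_le_trans _ D_ge1).
pose good sigma z := forall n, (word_map T (block_word sigma n) @` K) z.
have [phi Hphi] : {phi & forall sigma, good sigma (phi sigma)}.
  apply: choice => sigma.
  exact: (nested_limit (b := block \o sigma) (fun i => block_size_gt0 (sigma i))).
apply: (@cantor_hausdorff R _ a0 free d phi (fun k => b ^+ k * (D * r)) t
  ((D * r) `^ t)^-1) => //.
- by rewrite invr_gt0 powR_gt0.
- by move=> k; rewrite mulr_ge0 ?exprn_ge0// ltW.
- move=> sigma tau k _ _ st stk; exact: (block_word_separation st stk (Hphi _ _) (Hphi _ _)).
- move=> k; rewrite [(b ^+ k * _) `^ t]powRM ?exprn_ge0 ?(ltW b_gt0) ?(ltW Dr)//.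
  rewrite mulrCA mulVf ?mulr1 ?gt_eqF ?powR_gt0//.
  apply: (le_trans (mass_le k)); rewrite -powR_mulrn ?(ltW b_gt0)// -powRrM.
  apply: ger_powR; first by rewrite b_gt0 ltW.
  by rewrite mulrC ler_wpM2r.
- move=> e e0; have q0 : 0 <= b `^ (alpha * t2) by exact: powR_ge0.
  have q1 : b `^ (alpha * t2) < 1.
    by apply: powR_lt1 => //; [exact: ltW|exact: mulr_gt0].
  have [N HN] := expr_small q0 q1 e0.
  exists N; apply: (le_trans (mass_le N)).
  by rewrite powRrM powR_mulrn// ltW// HN.
- by move=> sigma s_adm; exact: (HE sigma _ s_adm (Hphi sigma)).
Qed.

End Subsystem.

(** * Counting the pieces of a given size *)

(** There are [m ^ j] pieces of generation [j], of size at most about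
    [cmax ^+ j]. *)
Lemma attractor_dim_fin : hausdorff_dim K \is a fin_num.
Proof.
have [N HN] : exists N, m%:R * cmax ^+ N.+1 < 1.
  have m1 : 0 < (m%:R + 1 : R)^-1 by rewrite invr_gt0 ltr_pwDr.
  have [N HN] := expr_small (ltW cmax_gt0) cmax_lt1 m1.
  exists N; have := HN N.+1 (leqnSn N); rewrite -[ltRHS]mul1r ltr_pdivlMr ?ltr_pwDr//.
  by rewrite mulrC mulrDl mul1r; apply: lt_trans; rewrite ltrDl exprn_gt0.
rewrite fin_numElt (lt_le_trans _ (hausdorff_dim_ge0 K)) ?ltNyr//=.
apply: (@le_lt_trans _ _ N.+1%:R%:E); last exact: ltry.
apply: hausdorff_dim_le => //.
apply: (@hausdorff_cantelli _ _ _ _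
  (fun j => [seq word_map T (val t) x0 | t <- enum {: j.-tuple 'I_m}])
  (fun j => d%:R * D * cmax ^+ j) ((2 * (d%:R * D)) ^+ N.+1) (m%:R * cmax ^+ N.+1)) => //.
- by move=> j; rewrite mulr_ge0 ?exprn_ge0// ltW.
- by rewrite mulr_ge0// exprn_ge0// ltW.
- move=> j; rewrite size_map -cardE card_tuple card_ord powR_mulrn; last first.
    by rewrite !mulr_ge0// ?exprn_ge0// ltW// (lt_le_trans _ D_ge1).
  by rewrite natrX (mulrA 2) !exprMn [leLHS]mulrCA [cmax ^+ j ^+ _]exprAC.
- move=> e e0; have [J HJ] := expr_small (ltW cmax_gt0) cmax_lt1 (divr_gt0 e0 dD_gt0).
  by exists J => j /HJ /ltW; rewrite ler_pdivlMr// mulrC.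
move=> y Ky J; exists J => //; have [w wJ Hy] := word_pieces_cover J Ky.
exists (word_map T w x0).
  apply/mapP; exists (tcast wJ (in_tuple w)); first by rewrite mem_enum.
  by rewrite -[in LHS](val_tcast wJ (in_tuple w) : _ = w).
have := word_piece_diam Hy (ex_intro2 _ _ x0 Kx0 erefl).
by move/le_trans; apply; rewrite ler_pM2l// -wJ; exact: word_ratio_le.
Qed.

Variable s : R.
Hypothesis dimK : hausdorff_dim K = s%:E.

Let s_ge0 : 0 <= s.
Proof. by rewrite -lee_fin -dimK; exact: hausdorff_dim_ge0. Qed.

(** A large separated family would generate a subsystem whose attractor, a
    subset of [K], is too large for the dimension of [K]. *)
Lemma separated_family_size_le t : s < t ->
  exists2 r0, 0 < r0 < 1 & forall r V, 0 < r -> r < r0 ->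
    separated_family r V -> (size V)%:R <= r `^ (- t).
Proof.
move=> st; pose t1 := (s + t) / 2.
have st1 : s < t1 by rewrite /t1; lra.
have t1t : 0 < t - t1 by rewrite /t1; lra.
have t10 : 0 < t1 by exact: le_lt_trans st1.
have [r0 r01 Hr0] := powR_small t1t (powR_gt0 t1 cmin_gt0).
exists r0 => // r V r_gt0 rr0 V_sep; rewrite leNgt; apply/negP => sizeV.
have r1 : r < 1 by case/andP: r01 => _; exact: lt_trans.
have V0 : (0 < size V)%N by rewrite -(ltr_nat R) (le_lt_trans _ sizeV)// powR_ge0.
have : (t1%:E <= hausdorff_dim K)%E; last first.
  by rewrite dimK lee_fin leNgt st1.
apply: le_hausdorff_dim => t' t'0 t't1.
apply: (@subsystem_hausdorff r V r_gt0 V_sep (Ordinal V0) xpredT 1 t1 t') => //.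
- by rewrite mul1r ltW.
- apply: le_trans (ltW sizeV); rewrite powRM ?(ltW cmin_gt0) ?(ltW r_gt0)//.
  have -> : - t = (t1 - t) + - t1 by ring.
  rewrite powRD; last by apply/implyP => _; rewrite gt_eqF.
  rewrite ler_pM2r ?powR_gt0// -[t1 - t]opprB !powRN lef_pV2 ?posrE ?powR_gt0//.
  exact: Hr0.
- by move=> k; rewrite mul1r /free_count sum_nat_const_nat subn0 muln1.
- by move=> sigma z _ Hz; have := Hz 0%N => -[y Ky <-].
Qed.

(** The balls around the points of small separated families would be an
    efficient cover of [K]. *)
Lemma separated_family_size_ge t : 0 < t -> t < s ->
  exists2 r0, 0 < r0 < 1 & forall r V, 0 < r -> r < r0 ->
    separated_family r V -> (cmin * r) `^ (- t) <= (size V)%:R.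
Proof.
move=> t0 ts; pose t1 := (t + s) / 2.
have t1s : t1 < s by rewrite /t1; lra.
have tt1 : 0 < t1 - t by rewrite /t1; lra.
have t10 : 0 < t1 by rewrite /t1; lra.
apply: contrapT => Hn.
have Hbad (j : nat) : exists rV : R * seq (seq 'I_m), [/\ 0 < rV.1,
    rV.1 <= (1/2) ^+ j, rV.1 `^ (t1 - t) <= (1/2) ^+ j, separated_family rV.1 rV.2 &
    (size rV.2)%:R <= (cmin * rV.1) `^ (- t)].
  have h0 : 0 < (1/2 : R) ^+ j by rewrite exprn_gt0//; lra.
  have [r1 /andP[r10 r11] Hr1] := powR_small tt1 h0.
  apply: contrapT => Hj; apply: Hn; exists (Num.min r1 ((1/2) ^+ j)).
    by rewrite lt_min r10 h0 gt_min r11.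
  move=> r V r0; rewrite lt_min => /andP[rr1 rj] V_sep.
  rewrite leNgt; apply/negP => sizeV; apply: Hj; exists (r, V); split => //=.
  - exact: ltW.
  - exact: Hr1.
  - exact: ltW.
have [rV HrV] := choice Hbad.
have : (hausdorff_dim K <= t1%:E)%E; last by rewrite dimK lee_fin leNgt t1s.
apply: hausdorff_dim_le; first exact: ltW.
apply: (@hausdorff_cantelli _ _ _ _
  (fun j => [seq word_map T w x0 | w <- (rV j).2])
  (fun j => 4 * piece_size (rV j).1) (cmin `^ (- t) * (8 * (d%:R * D)) `^ t1) (1/2)) => //; try lra.
- by move=> j; rewrite mulr_ge0//; case: (HrV j) => rj _ _ _ _; exact/ltW/piece_size_gt0.
- move=> j; case: (HrV j); set r := (rV j).1; set V := (rV j).2.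
  move=> r0 _ rj _ sizeV; rewrite size_map.
  have -> : 2 * (4 * piece_size r) = (8 * (d%:R * D)) * r by rewrite /piece_size; ring.
  rewrite powRM ?(ltW r0)//; last by rewrite mulr_ge0// ltW.
  apply: (@le_trans _ _ ((cmin * r) `^ (- t) * ((8 * (d%:R * D)) `^ t1 * r `^ t1))).
    by rewrite ler_wpM2r// mulr_ge0// powR_ge0.
  rewrite powRM ?(ltW cmin_gt0) ?(ltW r0)// mulrACA ler_wpM2l ?mulr_ge0 ?powR_ge0//.
  rewrite -powRD; last by apply/implyP => _; rewrite gt_eqF.
  by rewrite addrC.
- move=> e e0.
  have h0 : (0 : R) <= 1/2 by lra.
  have h1 : (1/2 : R) < 1 by lra.
  have h4 : 0 < 4 * (d%:R * D) by rewrite mulr_gt0.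
  have [J HJ] := expr_small h0 h1 (divr_gt0 e0 h4).
  exists J => j /HJ /ltW; rewrite ler_pdivlMr// => Hj.
  apply: le_trans Hj; case: (HrV j) => r0 rj _ _ _.
  by rewrite /piece_size mulrA mulrC ler_wpM2r// mulr_ge0// ltW.
move=> y Ky J; exists J => //; case: (HrV J) => _ _ _ [_ _ _ /(_ y Ky)[v vV yv]] _.
by exists (word_map T v x0) => //; apply/mapP; exists v.
Qed.

(** * The upper bound *)

Definition approximable (i0 : 'I_m) (eta : R -> R) : set 'cV[R]_d :=
  [set y | K y /\
    infinite_set [set wk : seq 'I_m * nat |
      (wk.2 < size wk.1)%N /\
      `|y - canonical_proj T (eventually_periodic i0 wk.1 wk.2)|
        <= eta (diam (word_map T wk.1 @` K))]].

(** [word_level a w] selects the scale [cmax ^+ a] to which [w] belongs. As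
    [cmax] bounds the contraction ratios, all words of a level but the empty
    one are in the cutset of that scale. *)
Definition word_level (a : nat) (w : seq 'I_m) : Prop :=
  cmax ^+ a.+1 < word_ratio T w <= cmax ^+ a.

Lemma word_level_exists w : exists a, word_level a w.
Proof.
have [N HN] := expr_small (ltW cmax_gt0) cmax_lt1 (word_ratio_gt0 T w).
have ex : exists n, cmax ^+ n.+1 < word_ratio T w by exists N; exact: HN.
case: (ex_minnP ex) => a Ha amin; exists a; rewrite /word_level Ha /=.
case: a {Ha} amin => [|a] amin; first by rewrite expr0 word_ratio_le1.
by rewrite leNgt; apply/negP => /amin; rewrite ltnn.
Qed.

Lemma word_level_cutset a w : w != [::] -> word_level a w ->
  cutset T (cmax ^+ a) w.
Proof.
case/lastP: w => [//|w i] _ /andP[aw wa]; split; first by rewrite size_rcons.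
rewrite wa /= size_rcons -cats1 take_size_cat//.
move: aw; rewrite -cats1 word_ratio_cat {2}/word_ratio big_seq1 exprSr => aw.
rewrite -(ltr_pM2r cmax_gt0); apply: (lt_le_trans aw).
by rewrite ler_pM2l ?word_ratio_gt0//; case/andP: (ratioP i).
Qed.

Lemma word_level_size a w : word_level a w -> (size w <= a)%N.
Proof.
move=> /andP[+ _] => /lt_le_trans/(_ (word_ratio_le w)).
by rewrite ltr_iXn2l.
Qed.

(** At the scale [r] few balls are needed to cover [K], by the bound on the
    separated families, and each of them meets few pieces. *)
Lemma level_maps_eventually s1 : AWSC T K -> s < s1 ->
  exists a0 C, 1 <= C /\ forall a, (a0 <= a)%N ->
    exists L : seq ('cV[R]_d -> 'cV[R]_d),
      (size L)%:R <= C * (cmax `^ (- s1)) ^+ a /\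
      forall w, word_level a w -> word_map T w \in L.
Proof.
move=> awsc ss1; pose e := (s1 - s) / 2; pose t := (s + s1) / 2.
have e0 : 0 < e by rewrite /e; lra.
have st : s < t by rewrite /t; lra.
have [r1 /andP[r10 _] H1] := awsc_maps_near awsc e0.
have [r2 /andP[r20 _] H2] := separated_family_size_le st.
(* At the scale [r * c] the covering balls have radius [r]. *)
pose c : R := (4 * (d%:R * D))^-1.
have c0 : 0 < c by rewrite invr_gt0 mulr_gt0.
have [a0 Ha0] : exists a0, forall a, (a0 <= a)%N ->
    cmax ^+ a < Num.min (Num.min r1 1) (Num.min r2 1 / c).
  by apply: expr_small; rewrite ?(ltW cmax_gt0)// !lt_min r10 ltr01 divr_gt0// lt_min r20 ltr01.
exists a0, (1 + c `^ (- t)); split; first by rewrite lerDl powR_ge0.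
move=> a /Ha0; set r := cmax ^+ a; have r0 : 0 < r by rewrite exprn_gt0.
rewrite !lt_min ltr_pdivlMr// lt_min => /andP[/andP[rr1 r_lt1] /andP[rc2 rc1]].
have rc0 : 0 < r * c by exact: mulr_gt0.
have [V V_sep] := separated_family_exists rc0 rc1.
have sizeV := H2 _ _ rc0 rc2 V_sep.
have radius : 4 * piece_size (r * c) = r.
  by rewrite /piece_size mulrA mulrCA mulfV ?mulr1// gt_eqF// mulr_gt0.
pose near_maps v : seq ('cV[R]_d -> 'cV[R]_d) :=
  finmap.enum_fset (fset_set (maps_near T K r (word_map T v x0))).
have K_word w : K (word_map T w x0) by apply: (@word_piece_sub w); exists x0.
have near_fin v : finite_set (maps_near T K r (word_map T v x0)) /\
    (size (near_maps v))%:R <= r `^ (- e).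
  have := H1 r _ r0 rr1 (K_word v); rewrite /counting; case: ifPn => [/asboolP fin|_].
    by rewrite lee_fin.
  by rewrite leNgt ltry.
(* [idfun] is the map of the empty word, which is in no cutset. *)
exists (idfun :: flatten [seq near_maps v | v <- V]); split.
  rewrite /= -natr1 addrC mulrDl mul1r; apply: lerD.
    by rewrite exprn_ege1// -(powRr0 cmax) ger_powR ?cmax_gt0 ?(ltW cmax_lt1)// oppr_le0 (le_trans s_ge0) ?ltW.
  apply: (@le_trans _ _ ((size V)%:R * r `^ (- e))).
    by apply: size_flatten_le => v _; case: (near_fin v).
  apply: (@le_trans _ _ ((r * c) `^ (- t) * r `^ (- e))).
    by rewrite ler_wpM2r ?powR_ge0.
  rewrite powRM ?(ltW r0) ?(ltW c0)// mulrAC mulrC ler_wpM2l ?powR_ge0//.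
  rewrite -powRD; last by apply/implyP => _; rewrite gt_eqF.
  rewrite -powR_mulrn ?powR_ge0// -powRrM mulrC powRrM powR_mulrn ?(ltW cmax_gt0)//.
  by rewrite le_eqVlt (_ : - t - e = - s1) ?eqxx// /t /e; lra.
move=> w wa; rewrite in_cons; have [->|w0] := eqVneq w [::].
  by apply/orP; left; apply/eqP.
apply/orP; right; apply/flattenP.
case: V_sep => _ _ _ /(_ _ (K_word w))[v vV wv].
exists (near_maps v); first exact: map_f.
rewrite (in_fset_set (near_fin v).1 : _ =i _) inE.
exists w => //; split; first exact: word_level_cutset.
exists (word_map T w x0); split; first by exists x0.
by rewrite /= -radius.
Qed.

(** The finitely many large scales, where all words are listed, only affect the
    constant. *)
Lemma level_maps s1 : AWSC T K -> s < s1 ->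
  exists C (L : nat -> seq ('cV[R]_d -> 'cV[R]_d)), 0 <= C /\ forall a,
    (size (L a))%:R <= C * (cmax `^ (- s1)) ^+ a /\
    forall w, word_level a w -> word_map T w \in L a.
Proof.
move=> awsc ss1; have [a0 [C [C1 HC]]] := level_maps_eventually awsc ss1.
pose L0 a := [seq word_map T w | w <- short_words m a].
have q1 a : 1 <= (cmax `^ (- s1)) ^+ a.
  by rewrite exprn_ege1// -(powRr0 cmax) ger_powR ?cmax_gt0 ?(ltW cmax_lt1)// oppr_le0 (le_trans s_ge0) ?ltW.
pose C' := C + \sum_(a < a0) (size (L0 a))%:R.
have S0 : 0 <= \sum_(a < a0) (size (L0 a))%:R :> R by apply: sumr_ge0.
have [L HL] : {L : nat -> seq ('cV[R]_d -> 'cV[R]_d) & forall a,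
    (size (L a))%:R <= C' * (cmax `^ (- s1)) ^+ a /\
    forall w, word_level a w -> word_map T w \in L a}.
  apply: (@choice _ _ (fun a (L : seq ('cV[R]_d -> 'cV[R]_d)) =>
    (size L)%:R <= C' * (cmax `^ (- s1)) ^+ a /\
    forall w, word_level a w -> word_map T w \in L)) => a.
  have [/HC[L [sizeL HL]]|aa0] := leqP a0 a.
    exists L; split => //; apply: (le_trans sizeL).
    by rewrite ler_wpM2r ?lerDl// (le_trans ler01).
  exists (L0 a); split; last first.
    by move=> w /word_level_size wa; apply: map_f; rewrite mem_short_words.
  apply: (@le_trans _ _ C'); last by rewrite ler_peMr// addr_ge0// (le_trans ler01).
  rewrite /C' (bigD1 (Ordinal aa0))//= addrCA lerDl addr_ge0//.
    exact: le_trans C1.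
  exact: sumr_ge0.
by exists C', L; split => //; rewrite addr_ge0// (le_trans ler01).
Qed.

(** A word map may fail to contract the sup norm, but its large iterates do. *)
Lemma word_fixed_point_unique v p x : (0 < size v)%N ->
  word_map T v p = p -> word_map T v x = x -> x = p.
Proof.
move=> v0 vp vx; have fixn y n : word_map T v y = y ->
    word_map T (flatten (nseq n v)) y = y.
  by move=> vy; elim: n => //= n IH; rewrite word_map_cat /= IH vy.
have d0 : 0 < (d%:R : R)^-1 by rewrite invr_gt0.
have [N HN] := expr_small (ltW cmax_gt0) cmax_lt1 d0.
have := word_lipschitz hd T (flatten (nseq N v)) x p.
rewrite !fixn//; set c := word_ratio _ _.
have c1 : d%:R * c < 1.
  rewrite mulrC -ltr_pdivlMr// mul1r; apply: le_lt_trans (HN N (leqnn N)).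
  apply: (le_trans (word_ratio_le _)); apply: ler_wiXn2l; [exact: ltW|exact: ltW|].
  by elim: (N) => //= n IH; rewrite size_cat; lia.
move=> xp; apply/eqP; rewrite -subr_eq0 -normr_le0 leNgt; apply/negP => xp0.
by move: xp; rewrite leNgt -[ltRHS]mul1r ltr_pM2r// c1.
Qed.

(** A word admits finitely many preperiods, and there are finitely many words of
    a given length. *)
Lemma infinitely_many_long (S : set (seq 'I_m * nat)) N : infinite_set S ->
  (forall wk, S wk -> (wk.2 < size wk.1)%N) ->
  exists2 wk, S wk & (N <= size wk.1)%N.
Proof.
move=> Sinf Sk; apply: contrapT => HN; apply: Sinf.
apply: (@sub_finite_set _ _ [set` [seq (w, k) | w <- short_words m N, k <- iota 0 N]]) => //.
move=> [w k] Swk; have wN : (size w < N)%N.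
  by rewrite ltnNge; apply/negP => Nw; apply: HN; exists (w, k).
apply/allpairsP; exists (w, k); rewrite mem_short_words mem_iota ltnW//=; split => //.
by rewrite add0n (ltn_trans (Sk _ Swk)).
Qed.

(** A point coded by a preperiod and a period depends on their two maps only,
    so the centers at a given scale are counted by pairs of maps. *)
Lemma approximable_null i0 (eta : R -> R) (Delta t : R) : AWSC T K ->
  (forall r r', 0 <= r -> r <= r' -> eta r <= eta r') ->
  (exists2 r0, 0 < r0 < 1 & forall r, 0 < r -> r < r0 -> eta r <= r `^ Delta) ->
  0 < Delta -> 0 < t -> s < Delta * t ->
  hausdorff_measure t (approximable i0 eta) = 0%E.
Proof.
move=> awsc eta_mono [r0 /andP[r00 _] Heta] Delta0 t0 sDt.
pose s1 := (s + Delta * t) / 2.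
have ss1 : s < s1 by rewrite /s1; lra.
have s1D : 0 < Delta * t - s1 by rewrite /s1; lra.
have [C [L [C0 HL]]] := level_maps awsc ss1.
pose center (g h : 'cV[R]_d -> 'cV[R]_d) := g (xget 0 [set x | h x = x]).
have [J0 HJ0] := expr_small (ltW cmax_gt0) cmax_lt1 (divr_gt0 r00 dD_gt0).
pose rho j := (d%:R * D * cmax ^+ j) `^ Delta.
have scale0 j : 0 < d%:R * D * cmax ^+ j by rewrite mulr_gt0// exprn_gt0.
pose x := cmax `^ (Delta * t - s1).
have [C2 [y [C20 y0 y1 Hy]]] : exists C y : R,
    [/\ 0 <= C, 0 <= y, y < 1 & forall j, j.+1%:R * x ^+ j <= C * y ^+ j].
  by apply: arithmetic_geometric_le; rewrite ?powR_gt0// powR_lt1// ltW.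
apply: (@hausdorff_cantelli _ _ _ _
  (fun j => flatten [seq [seq center g h | g <- L a, h <- L (j - a)%N] | a <- iota 0 j.+1])
  rho (C ^+ 2 * (2 `^ t * (d%:R * D) `^ (Delta * t)) * C2) y) => //.
- by move=> j; exact: powR_ge0.
- move=> j; set q := cmax `^ (- s1).
  apply: (@le_trans _ _ ((j.+1%:R * (C ^+ 2 * q ^+ j)) * (2 * rho j) `^ t)).
    apply: ler_wpM2r; first exact: powR_ge0.
    rewrite -[X in X%:R * _](size_iota 0 j.+1); apply: size_flatten_le => a.
    rewrite mem_iota add0n ltnS => /andP[_ aj]; rewrite size_allpairs natrM.
    rewrite -{2}(subnKC aj) exprD expr2 mulrACA.
    by apply: ler_pM => //; [case: (HL a)|case: (HL (j - a)%N)].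
  rewrite /rho powRM ?powR_ge0// -powRrM powRM ?exprn_ge0 ?(ltW cmax_gt0) ?(ltW dD_gt0)//.
  rewrite powR_exprn ?(ltW cmax_gt0)//.
  have xE : x ^+ j = q ^+ j * (cmax `^ (Delta * t)) ^+ j.
    rewrite -exprMn -powRD ?(addrC (- s1))//; apply/implyP => _.
    by rewrite gt_eqF.
  set A := 2 `^ t; set B := (d%:R * D) `^ _; set Z := (cmax `^ _) ^+ j in xE *.
  have -> : j.+1%:R * (C ^+ 2 * q ^+ j) * (A * (B * Z)) =
            C ^+ 2 * (A * B) * (j.+1%:R * x ^+ j) by rewrite xE; ring.
  by rewrite -[leRHS]mulrA ler_wpM2l ?mulr_ge0 ?sqr_ge0 ?powR_ge0.
- move=> e e0; have [r1 /andP[r10 _] Hr1] := powR_small Delta0 e0.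
  have [J HJ] := expr_small (ltW cmax_gt0) cmax_lt1 (divr_gt0 r10 dD_gt0).
  exists J => j Jj; apply: Hr1 => //.
  by rewrite mulrC -ltr_pdivlMr// HJ.
move=> z [Kz zinf] J; pose J1 := maxn J J0.
have [|[w k] [kw zw] Jw] := infinitely_many_long J1.+2 zinf; first by move=> wk [].
rewrite /= in kw zw Jw.
have [a Ha] := word_level_exists (take k w).
have [b Hb] := word_level_exists (drop k w).
have wE : word_ratio T w = word_ratio T (take k w) * word_ratio T (drop k w).
  by rewrite -word_ratio_cat cat_take_drop.
have wab : word_ratio T w <= cmax ^+ (a + b).
  rewrite wE exprD; case/andP: Ha => _ Ha; case/andP: Hb => _ Hb.
  by apply: ler_pM => //; exact/ltW/word_ratio_gt0.
have J1ab : (J1 <= a + b)%N.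
  have : cmax ^+ (a.+1 + b.+1) < cmax ^+ (size w).
    apply: lt_le_trans (word_ratio_le w); rewrite wE exprD.
    case/andP: Ha => Ha _; case/andP: Hb => Hb _.
    by apply: ltr_pM => //; rewrite exprn_ge0// ltW.
  by rewrite ltr_iXn2l// addSn addnS => H; rewrite -ltnS -ltnS ltnW// (leq_ltn_trans Jw).
exists (a + b)%N; first exact: leq_trans (leq_maxl _ _) J1ab.
exists (canonical_proj T (eventually_periodic i0 w k)).
  have [_ [p pfix zE]] := eventually_periodic_proj i0 kw.
  apply/flattenP; exists [seq center g h | g <- L a, h <- L (a + b - a)%N].
    by apply/mapP; exists a => //; rewrite mem_iota add0n ltnS leq_addr.
  apply/allpairsP; exists (word_map T (take k w), word_map T (drop k w)) => /=.
  split; [exact: (HL a).2|by rewrite addKn; exact: (HL b).2|].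
  rewrite zE /center; congr (word_map T _ _).
  have v0 : (0 < size (drop k w))%N by rewrite size_drop subn_gt0.
  case: xgetP => [x' _ /= x'fix|/(_ p)//].
  exact: (word_fixed_point_unique v0 x'fix pfix).
apply: (le_trans zw).
have in_piece : (word_map T w @` K) (word_map T w x0) by exists x0.
have diam_w : diam (word_map T w @` K) <= d%:R * D * cmax ^+ (a + b).
  apply: diam_le; first by exists (word_map T w x0).
  move=> x1 x2 H1 H2; apply: (le_trans (word_piece_diam H1 H2)).
  by rewrite ler_pM2l.
have diam0 : 0 <= diam (word_map T w @` K).
  have := le_diam (@word_piece_diam w) in_piece in_piece.
  by rewrite subrr normr0.
apply: (le_trans (eta_mono _ _ diam0 diam_w)); apply: Heta => //.
rewrite mulrC -ltr_pdivlMr//; apply: HJ0.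
exact: leq_trans (leq_maxr _ _) J1ab.
Qed.

(** * The lower bound *)

Lemma block_word_run r V (V_sep : separated_family r V)
    (sigma : nat -> 'I_(size V)) a n q :
  (forall j, (n <= j)%N -> (j < n + q)%N -> sigma j = a) ->
  block_word sigma (n + q) = block_word sigma n ++ flatten (nseq q (block a)).
Proof.
elim: q => [|q IH] Hj; first by rewrite addn0 /= cats0.
rewrite addnS block_wordS IH => [|j nj jq]; last first.
  by apply: Hj => //; rewrite addnS ltnS ltnW.
rewrite Hj ?leq_addr ?addnS// -catA -[q.+1]addn1 nseqD flatten_cat /=.
by rewrite cats0.
Qed.

(** The Cantor set of the points whose coding sequence repeats the letter [a0]
    in the windows from [n i] to [M (n i)] consists of approximable points: up to the
    end of a window such a sequence agrees with the eventually periodic one of period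
    [block a0]. The windows are so sparse that a proportion [alpha] of the
    letters stays free, where [alpha * Delta < 1]. *)
Lemma approximable_dim_ge i0 (eta : R -> R) (Delta t : R) :
  (forall r r', 0 <= r -> r <= r' -> eta r <= eta r') ->
  (forall r0, 0 < r0 -> exists r, [/\ 0 < r, r < r0 & r `^ Delta <= eta r]) ->
  1 <= Delta -> 0 < t -> Delta * t < s ->
  (t%:E <= hausdorff_dim (approximable i0 eta))%E.
Proof.
move=> eta_mono Heta Delta1 t0 Dts.
have Delta0 : 0 < Delta by exact: lt_le_trans Delta1.
have tD : t <= Delta * t by rewrite ler_peMl// ltW.
pose t2 := (Delta * t + s) / 2.
have t2s : t2 < s by rewrite /t2; lra.
have Dt2 : Delta * t < t2 by rewrite /t2; lra.
have t20 : 0 < t2 by rewrite (le_lt_trans _ Dt2)// (le_trans (ltW t0)).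
pose alpha := t / t2.
have alpha0 : 0 < alpha by rewrite divr_gt0.
have aD1 : Delta * alpha < 1 by rewrite /alpha mulrA ltr_pdivrMr// mul1r.
(* [y] absorbs the gap between the smallest and the largest contraction ratio
   of the subsystem, and [theta] is the relative length of the windows. *)
pose y := (Delta * alpha + 1) / 2.
have y1 : y < 1 by rewrite /y; lra.
have Day : Delta * alpha < y by rewrite /y; lra.
have y0 : 0 < y by rewrite (lt_trans _ Day)// mulr_gt0.
pose theta := (Delta / y + alpha^-1) / 2.
have Dya : Delta / y < alpha^-1.
  by rewrite ltr_pdivrMr// mulrC ltr_pdivlMr.
have Dyt : Delta < y * theta.
  by rewrite mulrC -ltr_pdivrMr// /theta; lra.
have at1 : alpha * theta < 1.
  by rewrite mulrC -ltr_pdivlMr// div1r /theta; lra.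
have theta1 : 1 < theta.
  rewrite -(ltr_pM2l y0) mulr1; apply: lt_trans Dyt; exact: lt_le_trans Delta1.
have theta0 : 0 < theta by exact: lt_trans theta1.
have at0 : 0 < alpha * theta by exact: mulr_gt0.
have a1 : alpha < 1 by apply: le_lt_trans aD1; rewrite ler_peMl// ltW.
have [r1 /andP[r10 r11] Hr1] := separated_family_size_ge t20 t2s.
have y10 : 0 < 1 - y by rewrite subr_gt0.
have [r2 /andP[r20 r21] Hr2] := powR_small y10 (powR_gt0 y cmin_gt0).
have [r [r0 rr1 rr2]] : exists r, [/\ 0 < r, r < r1 & r < r2].
  exists (Num.min r1 r2 / 2); have : 0 < Num.min r1 r2 by rewrite lt_min r10.
  by move=> h; split; [by rewrite divr_gt0| |]; apply: (@lt_le_trans _ _ (Num.min r1 r2));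
    rewrite ?ge_min ?lexx ?orbT//; lra.
have r_lt1 : r < 1 by exact: lt_trans r11.
pose b := cmin * r.
have b0 : 0 < b by exact: mulr_gt0.
have b1 : b < 1 by rewrite mulr_ilt1 ?(ltW cmin_gt0) ?(ltW r0).
have rb : r <= b `^ y.
  rewrite powRM ?(ltW cmin_gt0) ?(ltW r0)//.
  apply: (@le_trans _ _ (r `^ (1 - y) * r `^ y)); last first.
    by rewrite ler_wpM2r ?powR_ge0 ?Hr2.
  rewrite -powRD; last by apply/implyP => _; rewrite gt_eqF.
  by rewrite subrK powRr1 ?(ltW r0).
have [V V_sep] := separated_family_exists r0 r_lt1.
have sizeV := Hr1 r V r0 rr1 V_sep.
have V1 : (1 < size V)%N.
  rewrite -(ltr_nat R); apply: lt_le_trans sizeV.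
  by rewrite powRN invf_gt1 ?powR_gt0// powR_lt1// ltW.
pose a0 : 'I_(size V) := Ordinal (ltnW V1).
pose a1' : 'I_(size V) := Ordinal V1.
pose e0 := D * r.
have e00 : 0 < e0 by rewrite mulr_gt0// (lt_le_trans _ D_ge1).
(* Two letters give two points of [K] at distance at least
   [piece_size r]. *)
have diam_ge w : word_ratio T w * e0 <= diam (word_map T w @` K).
  pose p := word_map T (block a0) x0; pose q := word_map T (block a1') x0.
  have Kp : K p by apply: (@word_piece_sub (block a0)); exists x0.
  have Kq : K q by apply: (@word_piece_sub (block a1')); exists x0.
  have pq : piece_size r <= `|p - q|.
    case: V_sep => uV _ sep _; apply: (sep (block a0) (block a1')).
    - exact: block_mem.
    - exact: block_mem.
    - by rewrite nth_uniq.
    - by exists x0.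
    - by exists x0.
  rewrite -(ler_pM2l d_gt0); apply: (@le_trans _ _ (word_ratio T w * `|p - q|)).
    by rewrite mulrCA ler_pM2l ?word_ratio_gt0// /e0 mulrA.
  apply: (le_trans (word_expand hd T w p q)); rewrite ler_pM2l//.
  by apply: (le_diam (@word_piece_diam w)); [exists p|exists q].
pose M n := Num.truncn (theta * n%:R).
have good := good_scale b0 b1 r0 rb y0 e00 dD_gt0 Delta0 Dyt eta_mono Heta.
have [f Hf] : {f : nat -> nat & forall n0, (n0 <= f n0)%N /\
    d%:R * D * r ^+ M (f n0) <= eta (b ^+ (f n0).+1 * e0)}.
  apply: (@choice _ _ (fun n0 n => (n0 <= n)%N /\
    d%:R * D * r ^+ M n <= eta (b ^+ n.+1 * e0))) => n0.
  have [n n0n Hn] := good n0; by exists n.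
(* The start of the next window is large compared to the end of this one. *)
pose next k := f (maxn k.+1 (Num.truncn ((M k)%:R / (1 - alpha * theta))).+1).
pose n i := iter i next (f 1%N).
have n_incr i : (n i < n i.+1)%N.
  by rewrite /n /= /next; apply: leq_trans (Hf _).1; exact: leq_maxl.
have n_good i : d%:R * D * r ^+ M (n i) <= eta (b ^+ (n i).+1 * e0).
  by case: i => [|i]; exact: (Hf _).2.
have tn0 k : 0 <= theta * k%:R by rewrite mulr_ge0 ?ler0n// ltW.
have window_start i : (n i <= M (n i))%N.
  by rewrite /M truncn_ge_nat// ler_peMl ?ler0n// ltW.
have window_stop i : (M (n i))%:R <= theta * (n i)%:R by rewrite truncn_le.
have window_gap i : (M (n i))%:R <= (1 - alpha * theta) * (n i.+1)%:R.
  have h : 0 < 1 - alpha * theta by rewrite subr_gt0.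
  rewrite mulrC -ler_pdivrMr//; apply: (le_trans (ltW (truncnS_gt _))).
  rewrite ler_nat /n /= /next; apply: leq_trans (Hf _).1; exact: leq_maxr.
have n_ge i : (i <= n i)%N.
  by elim: i => // i IH; exact: leq_ltn_trans IH (n_incr i).
pose free := outside_windows n (fun i => M (n i)).
apply: le_hausdorff_dim => t' t'0 t't.
apply: (@subsystem_hausdorff r V r0 V_sep a0 free alpha t2 t') => //.
- by apply: (le_trans (ltW t't)); rewrite /alpha divfK// gt_eqF.
- by move=> k; apply: (@free_count_windows _ n (fun i => M (n i)) theta) => //; exact: ltW.
move=> sigma z s_adm Hz; split; first by have := Hz 0%N => -[z' Kz' <-].
move=> /finite_seqP[l Sl].
pose i := (\max_(p <- l) p.2).+1.
pose u := block_word sigma (n i); pose v := block a0.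
have v0 : (0 < size v)%N by exact: (block_size_gt0 V_sep).
have kw : (size u < size (u ++ v))%N by rewrite size_cat -[X in (X < _)%N]addn0 ltn_add2l.
have : [set` l] (u ++ v, size u).
  rewrite -Sl; split => //=.
  have [zq _] := eventually_periodic_proj i0 kw.
  move: zq; rewrite take_size_cat// drop_size_cat// => zq.
  have Mn : (M (n i) = n i + (M (n i) - n i))%N by rewrite subnKC.
  have window j : (n i <= j)%N -> (j < n i + (M (n i) - n i))%N -> sigma j = a0.
    rewrite -Mn => nj jM; apply: s_adm; apply/negP => /asboolP/(_ i).
    by rewrite nj jM.
  have := Hz (M (n i)); rewrite Mn (block_word_run V_sep window) => zM.
  apply: (le_trans (word_piece_diam zM (zq _))).
  rewrite -(block_word_run V_sep window) -Mn.
  have /andP[_ ratio_le] := block_word_ratio r0 V_sep sigma (M (n i)).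
  apply: (@le_trans _ _ (d%:R * D * r ^+ M (n i))); first by rewrite ler_pM2l.
  apply: (le_trans (n_good i)); apply: eta_mono.
    by rewrite mulr_ge0 ?exprn_ge0 ?(ltW b0) ?(ltW e00).
  apply: le_trans (diam_ge _); rewrite ler_pM2r// word_ratio_cat exprSr.
  have /andP[ratio_ge _] := block_word_ratio r0 V_sep sigma (n i).
  have /cutset_ratio/andP[bv _] := block_cutset V_sep a0.
  by apply: ler_pM => //; rewrite ?exprn_ge0 ?(ltW b0)// ltW.
move=> /= ul; have : (size u <= \max_(p <- l) p.2)%N.
  exact: (@leq_bigmax_seq _ _ xpredT (fun p : seq 'I_m * nat => p.2) (u ++ v, size u) ul).
rewrite leqNgt => /negP; apply.
apply: leq_trans (n_ge i) _; apply: size_flatten_mkseq => j.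
exact: (block_size_gt0 V_sep).
Qed.

(** * The dimension formula *)

Lemma approximable_dim_le_div i0 (eta : R -> R) (Delta : R) : AWSC T K ->
  (forall r r', 0 <= r -> r <= r' -> eta r <= eta r') ->
  1 < Delta -> (Delta%:E < lower_log_order eta)%E ->
  (hausdorff_dim (approximable i0 eta) <= (s / Delta)%:E)%E.
Proof.
move=> awsc eta_mono Delta1 /lower_log_order_gt Heta.
have Delta0 : 0 < Delta by exact: lt_trans Delta1.
apply/lee_addgt0Pr => e e0; rewrite -EFinD.
have t0 : 0 < s / Delta + e by rewrite ltr_wpDl// divr_ge0// ltW.
apply: hausdorff_dim_le; first exact: ltW.
apply: (approximable_null _ awsc eta_mono Heta) => //.
by rewrite mulrDr mulrCA mulfV ?gt_eqF// mulr1 ltrDl mulr_gt0.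
Qed.

Lemma approximable_dim_ge_div i0 (eta : R -> R) (Delta : R) :
  (forall r r', 0 <= r -> r <= r' -> eta r <= eta r') ->
  1 <= Delta -> (lower_log_order eta < Delta%:E)%E ->
  ((s / Delta)%:E <= hausdorff_dim (approximable i0 eta))%E.
Proof.
move=> eta_mono Delta1 /lower_log_order_lt Heta.
have Delta0 : 0 < Delta by exact: lt_le_trans Delta1.
apply/lee_addgt0Pr => e e0; rewrite -leeBlDr// -EFinB.
have [t0|t0] := leP (s / Delta - e) 0.
  by apply: le_trans (hausdorff_dim_ge0 _); rewrite lee_fin.
apply: (approximable_dim_ge _ eta_mono Heta) => //.
by rewrite mulrBr mulrCA mulfV ?gt_eqF// mulr1 gtrBl mulr_gt0.
Qed.

(** The two bounds hold for all [Delta] on either side of [max 1 delta]; let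
    [Delta] tend to that value. *)
Lemma approximable_dim i0 (eta : R -> R) : AWSC T K ->
  (forall r r', 0 <= r -> r <= r' -> eta r <= eta r') ->
  hausdorff_dim (approximable i0 eta) =
  (hausdorff_dim K / maxe 1 (lower_log_order eta))%E.
Proof.
move=> awsc eta_mono.
have dim_ge0 := hausdorff_dim_ge0 (approximable i0 eta).
set E := approximable i0 eta in dim_ge0 *; set delta := lower_log_order eta.
have dim_le : (hausdorff_dim E <= s%:E)%E.
  by rewrite -dimK; apply: hausdorff_dim_mono => y [].
have le_div Delta := @approximable_dim_le_div i0 eta Delta awsc eta_mono.
have ge_div Delta := @approximable_dim_ge_div i0 eta Delta eta_mono.
rewrite dimK; apply/eqP; rewrite eq_le; apply/andP; split; last first.
  have : (1 <= maxe 1 delta)%E by rewrite le_max lexx.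
  move mE : (maxe 1 delta)%E => [mu| |//] mu1; last by rewrite invey mule0.
  rewrite lee_fin in mu1; have mu0 : 0 < mu by exact: lt_le_trans mu1.
  rewrite inver gt_eqF// -EFinM; apply/lee_addgt0Pr => e e0.
  pose Delta := mu + e / (s + 1).
  have s1 : 0 < s + 1 by rewrite ltr_wpDl.
  have De : 0 < e / (s + 1) by rewrite divr_gt0.
  have muD : mu < Delta by rewrite /Delta ltrDl.
  have D0 : 0 < Delta by exact: lt_trans muD.
  apply: (@le_trans _ _ ((s / Delta)%:E + e%:E)%E); last first.
    apply: leeD => //; apply: ge_div; first exact: le_trans (ltW muD).
    by rewrite (@le_lt_trans _ _ mu%:E) ?lte_fin// -mE le_max lexx orbT.
  rewrite -EFinD lee_fin -lerBlDl.
  have -> : s / mu - s / Delta = s * (e / (s + 1)) / (mu * Delta).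
    rewrite /Delta; field; rewrite !gt_eqF//=.
    by rewrite ltr_wpDl// mulr_ge0// ltW.
  rewrite ler_pdivrMr ?mulr_gt0// mulrCA ler_pM2l//.
  apply: (@le_trans _ _ 1); first by rewrite ler_pdivrMr// mul1r lerDl.
  by rewrite mulr_ege1// (le_trans mu1)// ltW.
have [d1|d1] := leP delta 1%E.
  by rewrite inve1 mule1.
case dE : delta d1 => [mu| |] d1.
- rewrite lte_fin in d1; have mu0 : 0 < mu by exact: lt_trans d1.
  rewrite inver gt_eqF// -EFinM; apply/lee_addgt0Pr => e e0.
  have s1 : 0 < s + 1 by rewrite ltr_wpDl.
  pose h := Num.min ((mu - 1) / 2) (e / (s + 1)).
  have h0 : 0 < h by rewrite lt_min !divr_gt0// subr_gt0.
  have h1 : h <= (mu - 1) / 2 by rewrite ge_min lexx.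
  have h2 : h <= e / (s + 1) by rewrite ge_min lexx orbT.
  pose Delta := mu - h.
  have D1 : 1 < Delta by rewrite /Delta; lra.
  have D0 : 0 < Delta by exact: lt_trans D1.
  apply: (le_trans (le_div Delta D1 _)).
    by rewrite -/delta dE lte_fin /Delta; lra.
  rewrite -EFinD lee_fin -lerBlDl.
  have -> : s / Delta - s / mu = s * h / (Delta * mu).
    have hE : h = mu - Delta by rewrite /Delta; ring.
    by rewrite hE; field; rewrite !gt_eqF.
  rewrite ler_pdivrMr ?mulr_gt0//.
  apply: (@le_trans _ _ (s * (e / (s + 1)))); first by rewrite ler_wpM2l.
  rewrite mulrCA ler_pM2l//.
  apply: (@le_trans _ _ 1); first by rewrite ler_pdivrMr// mul1r lerDl.
  by rewrite mulr_ege1// ltW.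
- rewrite invey mule0; apply/lee_addgt0Pr => e e0; rewrite add0e.
  have D1 : 1 < 2 + s / e.
    by rewrite (@lt_le_trans _ _ 2)// ?lerDl ?divr_ge0// ?(ltW e0)//; lra.
  have D0 : 0 < 2 + s / e by exact: lt_trans D1.
  apply: (le_trans (le_div _ D1 _)); first by rewrite -/delta dE ltry.
  rewrite lee_fin ler_pdivrMr// mulrDr mulrCA mulfV ?gt_eqF// mulr1.
  by rewrite lerDr mulr_ge0// ltW.
- by [].
Qed.

End Attractor.

Theorem theorem4p1 (R : realType) (d m : nat) (hd : (0 < d)%N) (hm : (1 < m)%N)
    (T : 'I_m -> similarity R d) (K : set 'cV[R]_d)
    (K_attractor : is_attractor T K) (T_awsc : AWSC T K)
    (eta : R -> R)
    (eta_ge0 : forall r : R, 0 <= r -> 0 <= eta r)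
    (eta_ndecr : forall r s : R, 0 <= r -> r <= s -> eta r <= eta s) :
  hausdorff_dim
    [set y | K y /\
      infinite_set [set wk : seq 'I_m * nat |
        (wk.2 < size wk.1)%N /\
        `|y - canonical_proj T
                (eventually_periodic (Ordinal (ltnW hm)) wk.1 wk.2)|
          <= eta (diam (word_map T wk.1 @` K))]]
  = (hausdorff_dim K / maxe 1 (lower_log_order eta))%E.
Proof.
have [a [b [a0 a1 b0 b1 ab]]] := ratio_bounds T.
have [D D1 DP] := attractor_bounded K_attractor.
have [x0 Kx0] : K !=set0 by case: K_attractor.
have dimE : hausdorff_dim K = (fine (hausdorff_dim K))%:E.
  by rewrite fineK// (attractor_dim_fin hd K_attractor b0 b1 ab D1 DP Kx0).
exact: (approximable_dim hd K_attractor a0 a1 b0 b1 ab D1 DP Kx0 dimE).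
Qed.
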